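(* Let $p$ be a prime, let $R$ be an $F$-finite regular ring of characteristic $p$, and let $\mathfrak{a}=(f)$ be a principal ideal of $R$. Then every $F$-jumping exponent of $\mathfrak{a}$ is a rational number, and the set of $F$-jumping exponents of $\mathfrak{a}$ is a discrete subset of $\mathbb{R}$ (that is, it has no accumulation point in $\mathbb{R}$).
   Context: Rings are commutative; regular rings are Noetherian. A ring $R$ of characteristic $p>0$ is $F$-finite if the Frobenius morphism $F\colon R\to R$, $F(u)=u^p$, is finite. For an ideal $J$ and $e\ge 1$, $J^{[p^e]}=(u^{p^e}\mid u\in J)$. For an ideal $\mathfrak{b}$ of an $F$-finite regular ring $R$, $\mathfrak{b}^{[1/p^e]}$ denotes the (unique) minimal ideal $J$ such that $\mathfrak{b}\subseteq J^{[p^e]}$. For an ideal $\mathfrak{a}$ and a real number $\lambda\ge 0$, the ideals $\left(\mathfrak{a}^{\lceil\lambda p^e\rceil}\right)^{[1/p^e]}$ form an increasing sequence in $e$, and the test ideal is $\tau(\mathfrak{a}^{\lambda}):=\left(\mathfrak{a}^{\lceil\lambda p^e\rceil}\right)^{[1/p^e]}$ for $e\gg 0$ (with $\mathfrak{a}^0=R$). A real number $\lambda>0$ is an $F$-jumping exponent of $\mathfrak{a}$ if $\tau(\mathfrak{a}^{\lambda})\ne\tau(\mathfrak{a}^{\lambda'})$ for every $0\le\lambda'<\lambda$; by convention $0$ is also an $F$-jumping exponent. *)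

(* Defs.v *)
From HB Require Import structures.
From mathcomp Require Import all_boot all_order all_algebra.
From mathcomp Require Import all_classical all_reals all_analysis.

Set Implicit Arguments.
Unset Strict Implicit.
Unset Printing Implicit Defensive.

Import Order.TTheory GRing.Theory Num.Theory.
Import numFieldNormedType.Exports.

Local Open Scope classical_set_scope.
Local Open Scope ring_scope.

(* Ideals are represented by classical sets.  MathComp's [idealr_closed] is not
   usable here: it excludes the unit ideal, and it takes boolean predicates.   *)

Section Ideals.
Variable A : comNzRingType.
Implicit Types (I J S : set A) (n : nat).

Definition ideal I : Prop :=
  [/\ I 0, (forall x y, I x -> I y -> I (x + y)) &
      (forall a x, I x -> I (a * x))].

Definition ideal_gen S : set A :=
  [set x | exists n (a s : 'I_n -> A),
     (forall i, S (s i)) /\ x = \sum_(i < n) a i * s i].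

Definition ideal_mul I J : set A :=
  ideal_gen [set z | exists x y, [/\ I x, J y & z = x * y]].

Definition ideal_exp I n : set A := iter n (ideal_mul I) setT.

Definition prime_ideal I : Prop :=
  [/\ ideal I, ~ I 1 & forall x y, I (x * y) -> I x \/ I y].

Definition maximal_ideal I : Prop :=
  [/\ ideal I, ~ I 1 & forall J, ideal J -> ~ J 1 -> I `<=` J -> J = I].

Definition noetherian : Prop :=
  forall I, ideal I -> exists n (g : 'I_n -> A), I = ideal_gen (range g).

Definition prime_chain n (c : nat -> set A) : Prop :=
  (forall i, (i <= n)%N -> prime_ideal (c i)) /\
  (forall i, (i < n)%N -> c i `<` c i.+1).

(* [krull_dim n]: the Krull dimension of A is finite and equal to n *)
Definition krull_dim n : Prop :=
  (exists c, prime_chain n c) /\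
  (forall m, (exists c, prime_chain m c) -> (m <= n)%N).

Definition local_ring_at I : Prop :=
  maximal_ideal I /\ forall J, maximal_ideal J -> J = I.

Definition regular_local_ring : Prop :=
  noetherian /\
  exists m, local_ring_at m /\
    exists n, krull_dim n /\ exists g : 'I_n -> A, m = ideal_gen (range g).

End Ideals.

(* [phi] exhibits [B] as the localization of [A] at the complement of [P];
   these conditions determine [B] up to a unique isomorphism under [A].       *)
Definition is_localization_at (A B : comNzRingType) (phi : {rmorphism A -> B})
    (P : set A) : Prop :=
  [/\ forall s, ~ P s -> exists t, phi s * t = 1,
      forall x, exists a s, ~ P s /\ x * phi s = phi a &
      forall a, phi a = 0 -> exists s, ~ P s /\ s * a = 0].

Definition regular_ring (A : comNzRingType) : Prop :=
  noetherian A /\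
  forall P : set A, prime_ideal P ->
    exists (B : comNzRingType) (phi : {rmorphism A -> B}),
      is_localization_at phi P /\ regular_local_ring B.

Definition finite_morphism (A B : comNzRingType) (phi : {rmorphism A -> B}) :
    Prop :=
  exists n (g : 'I_n -> B), forall x, exists a : 'I_n -> A,
    x = \sum_(i < n) phi (a i) * g i.

Definition F_finite (p : nat) (R : comNzRingType) (charRp : p \in [pchar R]) :
    Prop :=
  finite_morphism (pFrobenius_aut charRp : {rmorphism R -> R}).

Section TestIdeals.
Variables (K : realType) (p : nat) (R : comNzRingType).
Implicit Types (I J T : set R) (e : nat) (lam : K).

Definition frob_power J e : set R :=
  ideal_gen [set x | exists2 u, J u & x = u ^+ (p ^ e)].

Definition is_frob_root I e J : Prop :=
  [/\ ideal J, I `<=` frob_power J e &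
      forall J', ideal J' -> I `<=` frob_power J' e -> J `<=` J'].

(* [xget setT P] is the element satisfying P when there is one; the default
   value [setT] is irrelevant when R is regular and F-finite.                 *)
Definition frob_root I e : set R := xget setT [set J | is_frob_root I e J].

Definition test_ideal_approx I lam e : set R :=
  frob_root (ideal_exp I `|Num.ceil (lam * (p ^ e)%:R)|%N) e.

Definition is_test_ideal I lam T : Prop :=
  exists e0, forall e, (e0 <= e)%N -> test_ideal_approx I lam e = T.

Definition test_ideal I lam : set R := xget setT [set T | is_test_ideal I lam T].

Definition F_jumping_exponent I : set K :=
  [set lam | lam = 0 \/
     (0 < lam /\ forall lam', 0 <= lam' -> lam' < lam ->
        test_ideal I lam <> test_ideal I lam')].

End TestIdeals.

(* Main.v *)
Require Import Defs.
From mathcomp Require Import all_boot all_order all_algebra perm.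
From mathcomp Require Import all_classical all_reals all_analysis.
From mathcomp Require Import ring lra.

Import Order.TTheory GRing.Theory Num.Theory.
Import numFieldNormedType.Exports.
Set Implicit Arguments.
Unset Strict Implicit.
Unset Printing Implicit Defensive.
Local Open Scope classical_set_scope.
Local Open Scope ring_scope.

(* Write tau(l) for the test ideal of f^l and, for an ideal I, I^[1/q] for its q-th Frobenius root.
   Regularity enters only through Kunz's theorem: locally, powers of a regular system of parameters form a
   regular sequence, so Frobenius is free; gluing gives p^-1-linear maps g_j and elements u_j with
   b = sum_j g_j(b)^p u_j for all b. Hence I^[1/p] is generated by the g_j(I), and
   tau((r + l) / p^e) = (f^r tau(l))^[1/p^e] for all l >= 0.

   As tau is decreasing in l, the ascending chain condition makes it constant just to the right of any point.
   Call x left stable when tau is constant just to the left of x. At x = r / (p^e - 1) this amounts to the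
   chain of iterated images of the p^-e-linear operator I |-> (f^r I)^[1/p^e] being stationary, which is the
   Hartshorne-Speiser-Lyubeznik-Gabber theorem; it propagates to r / (p^i (p^e - 1)). For a general x, let A
   be the ideal of those c such that every point of (0, 1] becomes left stable after inverting c. If A were
   proper, localise at a minimal prime N over A: finite length shows that every point is left stable at N, so
   by compactness there are finitely many jumps at N in (0, 1]; they are mapped to one another by
   l |-> p l modulo 1, hence rational of the shape above, hence globally left stable; by compactness again
   a single s outside N then lies in A, a contradiction. So every point is left stable: the jumps are
   isolated, and rational by the same finiteness argument. *)

(** * Ideals of Noetherian rings *)

Section IdealTheory.
Variable A : comNzRingType.
Implicit Types (I J L C D N P Q : set A) (x y a b s t c d : A).

Lemma ideal0 I : ideal I -> I 0. Proof. by case. Qed.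
Lemma idealD I x y : ideal I -> I x -> I y -> I (x + y).
Proof. by case=> _ h _; exact: h. Qed.
Lemma ideal_mull I a x : ideal I -> I x -> I (a * x).
Proof. by case=> _ _ h; exact: h. Qed.
Lemma ideal_mulr I a x : ideal I -> I x -> I (x * a).
Proof. by rewrite mulrC; exact: ideal_mull. Qed.
Lemma idealN I x : ideal I -> I x -> I (- x).
Proof. by move=> hI hx; rewrite -mulN1r; exact: ideal_mull. Qed.
Lemma idealB I x y : ideal I -> I x -> I y -> I (x - y).
Proof. by move=> hI hx hy; apply: idealD => //; exact: idealN. Qed.
Lemma ideal_addr I x y : ideal I -> I x -> I (x + y) -> I y.
Proof. by move=> hI hx hxy; rewrite -(addKr x y) addrC; exact: idealB. Qed.
Lemma ideal_sum I (T : Type) (r : seq T) (Pr : pred T) (F : T -> A) :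
  ideal I -> (forall i, Pr i -> I (F i)) -> I (\sum_(i <- r | Pr i) F i).
Proof.
by move=> hI h; elim/big_ind: _ => //; [exact: ideal0|move=> *; exact: idealD].
Qed.

Lemma ideal_setT : ideal [set: A]. Proof. by split. Qed.
Lemma ideal_eqT I : ideal I -> I 1 -> I = setT.
Proof.
by move=> hI h1; apply/seteqP; split=> // x _; rewrite -[x]mulr1; exact: ideal_mull.
Qed.

Lemma ideal_gen_ideal S : ideal (@ideal_gen A S).
Proof.
split.
- exists 0%N, (fun _ => 0), (fun _ => 0); split; first by case.
  by rewrite big_ord0.
- move=> _ _ [n [a [s [hs ->]]]] [m [b [t [ht ->]]]].
  exists (n + m)%N.
  exists (fun i => match fintype.split i with inl j => a j | inr j => b j end).
  exists (fun i => match fintype.split i with inl j => s j | inr j => t j end).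
  split; first by move=> i; case: (fintype.split i).
  rewrite big_split_ord /=; congr (_ + _); apply: eq_bigr => i _.
  + by rewrite (unsplitK (inl i)).
  + by rewrite (unsplitK (inr i)).
- move=> c _ [n [a [s [hs ->]]]]; exists n, (fun i => c * a i), s; split=> //.
  by rewrite mulr_sumr; apply: eq_bigr => i _; rewrite mulrA.
Qed.

Lemma sub_ideal_gen S : S `<=` @ideal_gen A S.
Proof.
move=> x hx; exists 1%N, (fun _ => 1), (fun _ => x); split=> //.
by rewrite big_ord1 mul1r.
Qed.

Lemma ideal_gen_min S I : ideal I -> S `<=` I -> ideal_gen S `<=` I.
Proof.
move=> hI hS _ [n [a [s [hs ->]]]]; apply: ideal_sum => // i _.
by apply: ideal_mull => //; apply: hS; exact: hs.
Qed.

Lemma ideal_genS S T : S `<=` T -> @ideal_gen A S `<=` ideal_gen T.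
Proof.
move=> hST; apply: ideal_gen_min; first exact: ideal_gen_ideal.
by apply: subset_trans hST _; exact: sub_ideal_gen.
Qed.

Lemma ideal_gen_rangeP n (g : 'I_n -> A) x :
  ideal_gen (range g) x <-> exists a : 'I_n -> A, x = \sum_i a i * g i.
Proof.
split; last first.
  move=> [a ->]; apply: ideal_sum => [|i _]; first exact: ideal_gen_ideal.
  by apply: ideal_mull; [exact: ideal_gen_ideal|apply: sub_ideal_gen; exists i].
suff h : ideal_gen (range g) `<=` [set x | exists a : 'I_n -> A, x = \sum_i a i * g i].
  exact: h.
apply: ideal_gen_min.
  split=> /=.
  - by exists (fun _ => 0); rewrite big1 // => i _; rewrite mul0r.
  - move=> _ _ [a ->] [b ->]; exists (fun i => a i + b i).
    by rewrite -big_split /=; apply: eq_bigr => i _; rewrite mulrDl.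
  - move=> c _ [a ->]; exists (fun i => c * a i).
    by rewrite mulr_sumr; apply: eq_bigr => i _; rewrite mulrA.
move=> _ [i _ <-] /=; exists (fun j => (j == i)%:R).
rewrite (bigD1 i) //= eqxx mul1r big1 ?addr0 // => j /negPf ->.
by rewrite mul0r.
Qed.

Definition iadd I J : set A := [set z | exists x y, [/\ I x, J y & z = x + y]].
Definition scale (c : A) I : set A := [set c * x | x in I].
Definition principal x : set A := scale x setT.
Definition colon L P : set A := [set a | forall x, P x -> L (x * a)].
(** For prime [N], the contraction to [A] of the extension of [I] to the localization at [N];
    statements at [N] are phrased with it inside [A]. *)
Definition sat N I : set A := [set a | exists s, ~ N s /\ I (s * a)].

Lemma scale_ideal c I : ideal I -> ideal (scale c I).
Proof.
move=> hI; split.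
- by exists 0; [exact: ideal0|rewrite mulr0].
- by move=> _ _ [x hx <-] [y hy <-]; exists (x + y); [exact: idealD|rewrite mulrDr].
- by move=> a _ [x hx <-]; exists (a * x); [exact: ideal_mull|rewrite mulrCA].
Qed.

Lemma scaleS c I J : I `<=` J -> scale c I `<=` scale c J.
Proof. by move=> h _ [x hx <-]; exists x => //; exact: h. Qed.

Lemma scale_sub c I : ideal I -> scale c I `<=` I.
Proof. by move=> hI _ [x hx <-]; exact: ideal_mull. Qed.

Lemma scaleA c d I : scale c (scale d I) = scale (c * d) I.
Proof.
apply/seteqP; split.
- by move=> _ [_ [x hx <-] <-]; exists x => //; rewrite mulrA.
- by move=> _ [x hx <-]; exists (d * x); [exists x|rewrite mulrA].
Qed.

Lemma scale1 I : scale 1 I = I.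
Proof.
apply/seteqP; split; first by move=> _ [x hx <-]; rewrite mul1r.
by move=> x hx; exists x; rewrite ?mul1r.
Qed.

Lemma principal_ideal x : ideal (principal x).
Proof. exact/scale_ideal/ideal_setT. Qed.

Lemma principal_id x : principal x x.
Proof. by exists 1; rewrite ?mulr1. Qed.

Lemma principal_sub x I : ideal I -> I x -> principal x `<=` I.
Proof. by move=> hI hx _ [a _ <-]; exact: ideal_mulr. Qed.

Lemma iadd_ideal I J : ideal I -> ideal J -> ideal (iadd I J).
Proof.
move=> hI hJ; split.
- by exists 0, 0; split; rewrite ?addr0 //; exact: ideal0.
- move=> _ _ [x [y [hx hy ->]]] [x' [y' [hx' hy' ->]]].
  exists (x + x'), (y + y'); split; [exact: idealD|exact: idealD|exact: addrACA].
- move=> a _ [x [y [hx hy ->]]]; exists (a * x), (a * y).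
  by split; rewrite ?mulrDr //; exact: ideal_mull.
Qed.

Lemma iaddl I J : ideal J -> I `<=` iadd I J.
Proof. by move=> hJ x hx; exists x, 0; split; rewrite ?addr0 //; exact: ideal0. Qed.
Lemma iaddr I J : ideal I -> J `<=` iadd I J.
Proof. by move=> hI x hx; exists 0, x; split; rewrite ?add0r //; exact: ideal0. Qed.
Lemma iadd_min I J L : ideal L -> I `<=` L -> J `<=` L -> iadd I J `<=` L.
Proof.
move=> hL hI hJ _ [x [y [hx hy ->]]].
by apply: idealD => //; [exact: hI|exact: hJ].
Qed.

Lemma colon_ideal L P : ideal L -> ideal (colon L P).
Proof.
move=> hL; split.
- by move=> x _; rewrite mulr0; exact: ideal0.
- by move=> a b ha hb x hx; rewrite mulrDr; apply: idealD => //; [exact: ha|exact: hb].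
- by move=> c a ha x hx; rewrite mulrCA; apply: ideal_mull => //; exact: ha.
Qed.

Lemma colonS L L' P : L `<=` L' -> colon L P `<=` colon L' P.
Proof. by move=> h a ha x hx; apply: h; exact: ha. Qed.

Lemma ideal_bigcap (T : Type) (J : T -> set A) :
  (forall i, ideal (J i)) -> ideal [set a | forall i, J i a].
Proof.
move=> hJ; split.
- by move=> i; exact: ideal0.
- by move=> x y hx hy i; apply: idealD.
- by move=> a x hx i; apply: ideal_mull.
Qed.

Section Prime.
Variable N : set A.
Hypothesis prN : prime_ideal N.

Lemma prime_ideal_ideal : ideal N. Proof. by case: prN. Qed.
Lemma prime1 : ~ N 1. Proof. by case: prN. Qed.
Lemma primeM x y : ~ N x -> ~ N y -> ~ N (x * y).
Proof. by move=> hx hy; case: prN => _ _ h /h[]. Qed.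
Lemma primeX x n : ~ N x -> ~ N (x ^+ n).
Proof.
move=> hx; elim: n => [|n IH]; first by rewrite expr0; exact: prime1.
by rewrite exprS; exact: primeM.
Qed.
Lemma prime_prod (T : Type) (r : seq T) (Pr : pred T) (F : T -> A) :
  (forall i, Pr i -> ~ N (F i)) -> ~ N (\prod_(i <- r | Pr i) F i).
Proof.
by move=> h; elim/big_ind: _ => //; [exact: prime1|move=> *; exact: primeM].
Qed.

Definition saturated I := forall s a, ~ N s -> I (s * a) -> I a.

Lemma sat_ideal I : ideal I -> ideal (sat N I).
Proof.
move=> hI; split.
- by exists 1; split; [exact: prime1|rewrite mulr0; exact: ideal0].
- move=> x y [s [hs hx]] [t [ht hy]]; exists (s * t); split; first exact: primeM.
  rewrite mulrDr; apply: idealD => //.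
  + by rewrite (mulrC s) -mulrA; exact: ideal_mull.
  + by rewrite -mulrA; exact: ideal_mull.
- move=> a x [s [hs hx]]; exists s; split=> //.
  by rewrite mulrCA; exact: ideal_mull.
Qed.

Lemma sub_sat I : I `<=` sat N I.
Proof. by move=> x hx; exists 1; rewrite mul1r; split=> //; exact: prime1. Qed.

Lemma satS I J : I `<=` J -> sat N I `<=` sat N J.
Proof. by move=> h x [s [hs hx]]; exists s; split=> //; exact: h. Qed.

Lemma sat_saturated I : saturated (sat N I).
Proof.
move=> s a hs [t [ht h]]; exists (t * s); split; first exact: primeM.
by rewrite -mulrA.
Qed.

Lemma sat_min I L : saturated L -> I `<=` L -> sat N I `<=` L.
Proof. by move=> hL hI a [s [hs h]]; apply: (hL s) => //; exact: hI. Qed.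

Lemma colon_saturated L P : saturated L -> saturated (colon L P).
Proof.
by move=> hL s a hs h x hx; apply: (hL s) => //; rewrite mulrCA; exact: h.
Qed.

End Prime.

Section Noetherian.
Hypothesis noethA : noetherian A.

Lemma noeth_acc_sub (J : nat -> set A) : (forall n, ideal (J n)) ->
  (forall n, J n `<=` J n.+1) -> exists n, forall m, J m `<=` J n.
Proof.
move=> hJ hS.
have hm : forall m n, (m <= n)%N -> J m `<=` J n.
  move=> m n /subnK <-; elim: (n - m)%N => [|k IH] //.
  by rewrite addSn; apply: subset_trans IH _.
have hU : ideal [set a | exists n, J n a].
  split.
  - by exists 0%N; exact: ideal0.
  - move=> x y [n hn] [m hm']; exists (maxn n m).
    apply: idealD => //.
    + by apply: (hm n) => //; exact: leq_maxl.
    + by apply: (hm m) => //; exact: leq_maxr.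
  - by move=> a x [n hn]; exists n; exact: ideal_mull.
have [k [g hg]] := noethA hU.
have /choice [r hr] : forall i, exists n, J n (g i).
  move=> i; suff: [set a | exists n, J n a] (g i) by [].
  by rewrite hg; apply: sub_ideal_gen; exists i.
exists (\max_i r i)%N => m x hx.
have: [set a | exists n, J n a] x by exists m.
rewrite hg => hx'; suff: ideal_gen (range g) `<=` J (\max_i r i)%N by exact.
apply: ideal_gen_min => // _ [i _ <-].
by apply: (hm (r i)) => //; exact: leq_bigmax.
Qed.

Lemma noeth_acc (J : nat -> set A) : (forall n, ideal (J n)) ->
  (forall n, J n `<=` J n.+1) -> exists n, forall m, (n <= m)%N -> J m = J n.
Proof.
move=> hJ hS; have [n hn] := noeth_acc_sub hJ hS; exists n => m hnm.
apply/seteqP; split; first exact: hn.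
move: hnm => /subnK <-; elim: (m - n)%N => [|k IH] //.
by rewrite addSn; apply: subset_trans IH _.
Qed.

(** Without a maximal member above [I0], choosing strictly larger members again and again would give
    a chain that never becomes stationary. *)
Lemma noeth_max (F : set (set A)) I0 : F I0 -> (forall I, F I -> ideal I) ->
  exists M, [/\ F M, I0 `<=` M & forall J, F J -> M `<=` J -> J = M].
Proof.
move=> hF0 hF; apply: contrapT => hno.
have step : forall I : {I | F I /\ I0 `<=` I}, exists J : {J | F J /\ I0 `<=` J},
    sval I `<=` sval J /\ sval J <> sval I.
  move=> [I [hI h0I]]; apply: contrapT => hJ; apply: hno; exists I; split=> // J FJ hIJ.
  apply: contrapT => hne; apply: hJ.
  by exists (exist _ J (conj FJ (subset_trans h0I hIJ))).
have [nx hnx] := choice step.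
pose s := fix s n := if n is n'.+1 then nx (s n') else exist _ I0 (conj hF0 (@subset_refl _ I0)).
have [n hn] := @noeth_acc (fun n => sval (s n)) (fun n => hF _ (proj1 (svalP (s n))))
  (fun n => proj1 (hnx (s n))).
by case: (hnx (s n)) => _; apply; exact: (hn n.+1).
Qed.

Lemma noeth_ind (Pr : set A -> Prop) :
  (forall I, ideal I -> (forall J, ideal J -> I `<=` J -> J <> I -> Pr J) -> Pr I) ->
  forall I, ideal I -> Pr I.
Proof.
move=> h I hI; apply: contrapT => hP.
have [|M [[hM hPM] _ hmax]] := @noeth_max [set I | ideal I /\ ~ Pr I] I (conj hI hP).
  by move=> J [].
apply: hPM; apply: h => // J hJ hMJ hne; apply: contrapT => hPJ.
by apply: hne; exact: hmax.
Qed.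

Lemma noeth_exists_maximal I : ideal I -> ~ I 1 ->
  exists M, maximal_ideal M /\ I `<=` M.
Proof.
move=> hI h1; have [|M [[hM hM1] hIM hmax]] :=
  @noeth_max [set J | ideal J /\ ~ J 1] I (conj hI h1); first by move=> J [].
by exists M; split=> //; split=> // J hJ hJ1 hMJ; exact: hmax.
Qed.

(* The colon ideals [(I : s)], [s] outside [N], are directed, so Noetherianity yields a common [s]. *)
Lemma uniform_denominator N I J : prime_ideal N -> ideal I ->
  J `<=` sat N I -> exists2 s, ~ N s & forall a, J a -> I (s * a).
Proof.
move=> prN hI hJ.
pose F : set (set A) := [set L | exists2 s, ~ N s & L = colon I [set s]].
have [||M [[s hs hM] _ hmax]] := @noeth_max F (colon I [set 1]).
- by exists 1 => //; exact: prime1.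
- by move=> L [s hs ->]; exact: colon_ideal.
exists s => // a ha; suff: M a by rewrite hM; exact.
have [t [ht hta]] := hJ _ ha.
rewrite -(hmax (colon I [set t * s])).
- by move=> _ ->; rewrite mulrAC; exact: ideal_mulr.
- by exists (t * s) => //; exact: primeM.
- rewrite hM => b hb _ ->; rewrite -mulrA; apply: ideal_mull => //; exact: hb.
Qed.

End Noetherian.

Lemma maximal_prime (M : set A) : maximal_ideal M -> prime_ideal M.
Proof.
move=> [hM hM1 hmax]; split=> // x y hxy; have [hx|hx] := pselect (M x); [by left|right].
have [h1|h1] := pselect (iadd M (principal x) 1).
  have [m [_ [hm [a _ <-] h]]] := h1.
  rewrite -[y]mul1r h mulrDl; apply: idealD => //; first exact: ideal_mulr.
  by rewrite mulrAC; exact: ideal_mulr.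
case: hx; rewrite -(hmax (iadd M (principal x))) //.
- by apply: iaddr => //; exact: principal_id.
- by apply: iadd_ideal => //; exact: principal_ideal.
- by apply: iaddl; exact: principal_ideal.
Qed.

End IdealTheory.

(** * Nakayama's lemma at a prime, with explicit denominators *)

Section Nakayama.
Variable A : comNzRingType.
Implicit Types (I J L C D N P Q : set A).

(* Cramer's rule: the determinant of [s%:M - M], [M] with entries in [D], is congruent to [s ^+ n] modulo [D]. *)
Lemma nakayama_gen N D C n (g : 'I_n -> A) s (M : 'M[A]_n) :
  prime_ideal N -> ideal D -> D `<=` N -> ideal C -> ~ N s ->
  (forall i j, D (M i j)) ->
  (forall i, C (s * g i - \sum_j M i j * g j)) ->
  exists2 t, ~ N t & forall i, C (t * g i).
Proof.
move=> prN hD hDN hC hs hM hg; have hN := prime_ideal_ideal prN.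
pose B : 'M[A]_n := s%:M - M; exists (\det B).
  rewrite /determinant (bigD1 (1%g : 'S_n)) //= odd_perm1 expr0 mul1r => hN'.
  have: N (\prod_i B i ((1%g : 'S_n) i)).
    rewrite addrC in hN'; apply: ideal_addr hN' => //; apply: ideal_sum => // sg hsg.
    (* A nontrivial permutation moves some [i], so its product contains an off-diagonal entry of
       [B], which lies in [N]. *)
    have [i hi] : exists i, sg i != i.
      apply/existsP; rewrite -negb_forall; apply: contra hsg => /forallP h.
      by apply/eqP/permP => i; rewrite perm1; exact/eqP.
    apply: ideal_mull => //; rewrite (bigD1 i) //=. rewrite mulrC; apply: (ideal_mull _ hN).
    rewrite !mxE eq_sym (negPf hi) mulr0n sub0r; apply: idealN => //; exact/hDN.
  apply: prime_prod => // i _; rewrite perm1 !mxE eqxx mulr1n => h.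
  apply: hs; rewrite -(subrK (M i i) s); apply: idealD => //; exact/hDN.
move=> i; pose v : 'cV[A]_n := \col_j g j.
have -> : \det B * g i = (\adj B *m (B *m v)) i 0.
  by rewrite mulmxA mul_adj_mx mul_scalar_mx !mxE.
rewrite mxE; apply: ideal_sum => // j _; apply: ideal_mull => //.
rewrite mxE; suff -> : \sum_k B j k * v k 0 = s * g j - \sum_k M j k * g k by [].
rewrite -[s * g j](_ : \sum_k s%:M j k * g k = _).
  by rewrite -sumrB; apply: eq_bigr => k _; rewrite !mxE mulrBl.
rewrite (bigD1 j) //= mxE eqxx mulr1n big1 ?addr0 // => k /negPf hk.
by rewrite mxE eq_sym hk mulr0n mul0r.
Qed.

Lemma ideal_mul_gen D n (g : 'I_n -> A) x : ideal D ->
  ideal_mul D (ideal_gen (range g)) x ->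
  exists2 a : 'I_n -> A, (forall j, D (a j)) & x = \sum_j a j * g j.
Proof.
move=> hD; pose L : set A :=
  [set x | exists2 a : 'I_n -> A, (forall j, D (a j)) & x = \sum_j a j * g j].
suff: ideal_mul D (ideal_gen (range g)) `<=` L by exact.
apply: ideal_gen_min.
  split.
  - by exists (fun=> 0) => [_|]; [exact: ideal0|rewrite big1 // => j _; rewrite mul0r].
  - move=> _ _ [a ha ->] [b hb ->]; exists (fun j => a j + b j).
      by move=> j; exact: idealD.
    by rewrite -big_split; apply: eq_bigr => j _; rewrite mulrDl.
  - move=> c _ [a ha ->]; exists (fun j => c * a j).
      by move=> j; exact: ideal_mull.
    by rewrite mulr_sumr; apply: eq_bigr => j _; rewrite mulrA.
move=> _ [y [z [hy /ideal_gen_rangeP[b ->] ->]]].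
exists (fun j => y * b j) => [j|]; first exact: ideal_mulr.
by rewrite mulr_sumr; apply: eq_bigr => j _; rewrite mulrA.
Qed.

(** Writing [s] times each generator of [J] modulo [C] with coefficients in [D] gives the matrix for
    [nakayama_gen]. The elements [s] and [t] replace the passage to the localization. *)
Lemma nakayama N D C J s : noetherian A -> ideal J ->
  prime_ideal N -> ideal D -> D `<=` N -> ideal C -> ~ N s ->
  (forall a, J a -> iadd (ideal_mul D J) C (s * a)) ->
  exists2 t, ~ N t & forall a, J a -> C (t * a).
Proof.
move=> noethA hJ prN hD hDN hC hs h.
have [n [g hg]] := noethA _ hJ.
have /choice[M hM] : forall i, exists a : 'I_n -> A,
    (forall j, D (a j)) /\ C (s * g i - \sum_j a j * g j).
  move=> i; have /h : J (g i) by rewrite hg; apply: sub_ideal_gen; exists i.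
  move=> [x [c [hx hc e]]]; rewrite hg in hx.
  have [a ha hxa] := ideal_mul_gen hD hx; exists a; split=> //.
  by rewrite e hxa addrAC subrr add0r.
have [||t ht h'] := @nakayama_gen N D C n g s (\matrix_(i, j) M i j) prN hD hDN hC hs.
- by move=> i j; rewrite mxE; exact: (proj1 (hM i)).
- move=> i; under eq_bigr do rewrite mxE; exact: (proj2 (hM i)).
exists t => // a; rewrite hg => /ideal_gen_rangeP[b ->].
rewrite mulr_sumr; apply: ideal_sum => // i _; rewrite mulrCA; exact: ideal_mull.
Qed.

Lemma nakayama_principal N C J x s : noetherian A -> ideal J ->
  prime_ideal N -> N x -> ideal C -> ~ N s ->
  (forall a, J a -> exists c b, [/\ C c, J b & s * a = c + x * b]) ->
  exists2 t, ~ N t & forall a, J a -> C (t * a).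
Proof.
move=> noethA hJ prN hx hC hs h.
apply: (@nakayama N (principal x) C J s) => //.
- exact: principal_ideal.
- exact: (principal_sub (prime_ideal_ideal prN)).
- move=> a /h [c [b [hc hb ->]]]; exists (x * b), c; rewrite addrC; split=> //.
  by apply: sub_ideal_gen; exists x, b; split=> //; exact: principal_id.
Qed.

End Nakayama.

(** * Minimal primes and chains of finite length at a prime *)

Section PrimaryDecomposition.
Variable A : comNzRingType.
Hypothesis noethA : noetherian A.
Implicit Types (I J L C D N P Q : set A).

(** Iterated quotients stand for $(L : P_1 \cdots P_n)$ and, in [colonn], for $(L : N^k)$, so that
    no product of ideals has to be formed. *)
Definition colons (ps : seq (set A)) L : set A := foldr (fun P L => colon L P) L ps.
Definition colonn N k L : set A := iter k (fun L => colon L N) L.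

Lemma colons_ideal ps L : ideal L -> ideal (colons ps L).
Proof. by move=> hL; elim: ps => //= P ps IH; exact: colon_ideal. Qed.

Lemma colonsS ps L L' : L `<=` L' -> colons ps L `<=` colons ps L'.
Proof. by move=> h; elim: ps => //= P ps IH; exact: colonS. Qed.

Lemma colons_cat ps qs L : colons (ps ++ qs) L = colons ps (colons qs L).
Proof. by rewrite /colons foldr_cat. Qed.

Lemma colonn_ideal N k L : ideal L -> ideal (colonn N k L).
Proof. by move=> hL; elim: k => //= k IH; exact: colon_ideal. Qed.

Lemma colonnS N k L L' : L `<=` L' -> colonn N k L `<=` colonn N k L'.
Proof. by move=> h; elim: k => //= k IH; exact: colonS. Qed.

Lemma sub_colonn N k L : ideal L -> L `<=` colonn N k L.
Proof.
move=> hL; elim: k => //= k IH; apply: subset_trans IH _ => a ha x _.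
by apply: ideal_mull => //; exact: colonn_ideal.
Qed.

Lemma colonn_saturated N k L : saturated N L -> saturated N (colonn N k L).
Proof. by move=> hL; elim: k => //= k IH; exact: colon_saturated. Qed.

Lemma colonn_mul N k L L' a : (forall d, L d -> L' (d * a)) ->
  forall z, colonn N k L z -> colonn N k L' (z * a).
Proof.
move=> h; elim: k => [|k IH] z /=; first exact: h.
by move=> hz x hx; rewrite mulrA; apply: IH; exact: hz.
Qed.

(* [colons ps D 1] says that the product of the primes [ps] lies in [D]. *)
Lemma prime_product_sub D : ideal D -> exists ps : seq (set A),
  (forall P, P \in ps -> prime_ideal P /\ D `<=` P) /\ colons ps D 1.
Proof.
move: D; apply: (noeth_ind noethA) => D hD IH.
have [h1|h1] := pselect (D 1); first by exists [::].
have [prD|nprD] := pselect (prime_ideal D).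
  exists [:: D]; split; first by move=> P; rewrite mem_seq1 => /eqP ->; split=> //; exact: subset_refl.
  by move=> x hx /=; rewrite mulr1.
have [x [y [hxy hx hy]]] : exists x y, [/\ D (x * y), ~ D x & ~ D y].
  apply: contrapT => h; apply: nprD; split=> // x y hxy; apply: contrapT.
  by move=> /not_orP [hx hy]; apply: h; exists x, y.
have hbig z : ~ D z -> exists ps : seq (set A),
    (forall P, P \in ps -> prime_ideal P /\ D `<=` P) /\
    colons ps (iadd D (principal z)) 1.
  move=> hz; have [||e|ps [hps1 hps2]] := IH (iadd D (principal z)).
  - by apply: iadd_ideal => //; exact: principal_ideal.
  - by apply: iaddl; exact: principal_ideal.
  - by apply: hz; rewrite -e; apply: iaddr => //; exact: principal_id.
  - exists ps; split=> // P /hps1 [hP h]; split=> //.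
    by apply: subset_trans h; apply: iaddl; exact: principal_ideal.
have [ps [hps1 hps2]] := hbig x hx; have [qs [hqs1 hqs2]] := hbig y hy.
exists (qs ++ ps); split.
  by move=> P; rewrite mem_cat => /orP[/hqs1|/hps1].
(* The product of [qs] lies in $D + (y)$, and the product of [ps] carries $D + (y)$ into [D],
   because it lies in $D + (x)$ and $xy \in D$. *)
rewrite colons_cat; apply: colonsS hqs2.
have step u v : D (u * v) -> colons ps (iadd D (principal u)) 1 -> colons ps D v.
  move=> huv.
  have h : forall z, colons ps (iadd D (principal u)) z -> colons ps D (z * v).
    elim: (ps) => [|P ps' IH'] z /=.
      move=> [d [_ [hd [a _ <-] ->]]]; rewrite mulrDl.
      apply: idealD => //; first exact: ideal_mulr.
      by rewrite mulrAC; exact: ideal_mulr.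
    by move=> hz t ht; rewrite mulrA; apply: IH'; exact: hz.
  by move=> /h; rewrite mul1r.
apply: iadd_min; first exact: colons_ideal.
- move=> d hd; elim: (ps) => //= P ps' IH' z hz.
  by apply: ideal_mull => //; exact: colons_ideal.
- by apply: principal_sub; [exact: colons_ideal|exact: (step x)].
Qed.

Definition minimal_over D N := prime_ideal N /\
  forall P, prime_ideal P -> D `<=` P -> P `<=` N -> P = N.

(** Some product of primes over [D] lies in [D]. At [N], a factor not contained in [N] becomes the
    unit ideal, and a factor contained in [N] equals [N] by minimality; a power of [N] remains. *)
Lemma minimal_over_colonn D N : ideal D -> minimal_over D N ->
  exists k, colonn N k (sat N D) 1.
Proof.
move=> hD [prN hmin]; have [ps [hps hc]] := prime_product_sub hD.
have {hc} : colons ps (sat N D) 1 by apply: colonsS hc; exact: sub_sat.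
suff h : forall z, colons ps (sat N D) z -> exists k, colonn N k (sat N D) z.
  exact: h.
have hsat : saturated N (sat N D) by exact: sat_saturated.
suff [k ->] : exists k, colons ps (sat N D) = colonn N k (sat N D) by move=> z; exists k.
elim: ps hps => [|P ps IH] hps; first by exists 0%N.
have [|k hk] := IH; first by move=> Q hQ; apply: hps; rewrite in_cons hQ orbT.
have [prP hDP] := hps P (mem_head _ _).
have [hPN|hPN] := pselect (P `<=` N).
  by exists k.+1; rewrite /= (hmin P prP hDP hPN) hk.
exists k; rewrite /= hk; apply/seteqP; split.
- have [s hs] : exists s, P s /\ ~ N s.
    by apply: contrapT => h; apply: hPN => x hx; apply: contrapT => hNx; apply: h; exists x.
  move=> a ha; apply: (@colonn_saturated N k _ hsat s); [exact: (proj2 hs)|].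
  by apply: ha; exact: (proj1 hs).
- move=> a ha x hx; apply: ideal_mull => //; apply: colonn_ideal; exact: sat_ideal.
Qed.

(** Every prime over [D] contains one of the finitely many primes whose product lies in [D], so an
    inclusion-minimal prime of that list is minimal over [D]. *)
Lemma exists_minimal_over D : ideal D -> ~ D 1 ->
  exists N, [/\ minimal_over D N, prime_ideal N & D `<=` N].
Proof.
move=> hD h1; have [ps [hps hc]] := prime_product_sub hD.
have hin : forall Q, prime_ideal Q -> D `<=` Q -> exists2 P, P \in ps & P `<=` Q.
  move=> Q prQ hDQ; apply: contrapT => hno; apply: (prime1 prQ).
  have: colons ps Q 1 by apply: colonsS hc.
  have: forall P, P \in ps -> ~ P `<=` Q by move=> P hP hPQ; apply: hno; exists P.
  elim: (ps) => [|P ps' IH] //= hps' hc'.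
  apply: IH; first by move=> P' hP'; apply: hps'; rewrite in_cons hP' orbT.
  have [s [hs hsQ]] : exists s, P s /\ ~ Q s.
    apply: contrapT => h; apply: (hps' P (mem_head _ _)) => x hx.
    by apply: contrapT => hNx; apply: h; exists x.
  have satc : saturated Q (colons ps' Q).
    elim: (ps') => [|P' ps'' IH''] /=; last exact: colon_saturated.
    by move=> u v hu huv; case: prQ => _ _ /(_ _ _ huv) [].
  by apply: (satc s) => //; exact: hc'.
have hmin : forall qs : seq (set A), qs != [::] ->
    exists2 P, P \in qs & forall Q, Q \in qs -> Q `<=` P -> Q = P.
  elim=> // P qs IH _; have [->|hq] := eqVneq qs [::].
    by exists P; rewrite ?mem_head // => Q; rewrite mem_seq1 => /eqP.
  have [P' hP' hP'min] := IH hq.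
  have [hPP'|hPP'] := pselect (P `<=` P').
    exists P; rewrite ?mem_head // => Q; rewrite in_cons => /orP[/eqP //|hQ hQP].
    have e : Q = P' by apply: hP'min => //; exact: subset_trans hQP hPP'.
    by apply/seteqP; split=> //; rewrite e.
  exists P'; first by rewrite in_cons hP' orbT.
  by move=> Q; rewrite in_cons => /orP[/eqP -> //|]; exact: hP'min.
have [|P hP hPmin] := hmin ps.
  by apply/eqP => e; rewrite e in hc.
have [prP hDP] := hps P hP.
exists P; split=> //; split=> // Q prQ hDQ hQP.
have [P' hP' hP'Q] := hin Q prQ hDQ.
have e : P' = P by apply: hPmin => //; exact: subset_trans hQP.
by apply/seteqP; split=> //; rewrite -e.
Qed.

(* Finite length of [A_N / L_N] when [N ^ k] kills [J 0 / L] at [N]: induction on [L], splitting off a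
   copy of the residue field generated by some [a] with [N a <= L]. *)
Lemma saturated_dcc N k L (J : nat -> set A) : prime_ideal N ->
  ideal L -> saturated N L -> (forall n, ideal (J n)) ->
  (forall n, saturated N (J n)) -> (forall n, L `<=` J n) ->
  (forall m n, (m <= n)%N -> J n `<=` J m) -> J 0%N `<=` colonn N k L ->
  exists n, forall m, (n <= m)%N -> J m = J n.
Proof.
move=> prN hL; have hN := prime_ideal_ideal prN.
move: L hL J; apply: (noeth_ind noethA) => L hL IH J satL hJ satJ hLJ decJ hk.
have [hJ0|hJ0] := pselect (J 0%N `<=` L).
  exists 0%N => m _; apply/seteqP; split; first exact: decJ.
  by apply: subset_trans hJ0 _.
(* Starting from [b] outside [L], multiply by elements of [N] as long as the result stays outside
   [L]; this ends within [k] steps, at a socle element. *)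
have [a [haJ haL haN]] : exists a, [/\ J 0%N a, ~ L a & forall x, N x -> L (x * a)].
  have [b [hb hbL]] : exists b, J 0%N b /\ ~ L b.
    by apply: contrapT => h; apply: hJ0 => b hb; apply: contrapT => hbL; apply: h; exists b.
  have := hk _ hb.
  elim: {hk} (k) b hb hbL => [|k' IHk] b hb hbL //= hk.
  have [hall|/existsNP[x /not_implyP[hx hxL]]] := pselect (forall x, N x -> L (x * b)).
    by exists b.
  by apply: (IHk (x * b)) => //; [exact: ideal_mull|exact: hk].
have hA I : ideal I -> ideal (iadd I (principal a)).
  by move=> hI; apply: iadd_ideal => //; exact: principal_ideal.
pose L' := sat N (iadd L (principal a)); pose J' n := sat N (iadd (J n) (principal a)).
have IJ' I : I `<=` sat N (iadd I (principal a)).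
  apply: (@subset_trans _ (iadd I (principal a))); last exact: sub_sat.
  by apply: iaddl; exact: principal_ideal.
have LL' : L `<=` L' := @IJ' L.
have JJ' n : J n `<=` J' n := @IJ' (J n).
have L'a : L' a.
  by apply: (@sub_sat _ N prN _ a); apply: iaddr => //; exact: principal_id.
have iaddS I I' : I `<=` I' -> iadd I (principal a) `<=` iadd I' (principal a).
  by move=> h _ [u [v [hu hv ->]]]; exists u, v; split=> //; exact: h.
have [|e|||||||n0 hn0] := IH L' _ LL' _ J'.
- exact/sat_ideal/hA.
- by apply: haL; rewrite -e.
- exact: sat_saturated.
- by move=> n; apply/sat_ideal => //; exact/hA.
- by move=> n; exact: sat_saturated.
- by move=> n; apply: satS; apply: iaddS.
- by move=> m n hmn; apply: satS; apply: iaddS; exact: decJ.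
- apply: sat_min; first by apply: colonn_saturated; exact: sat_saturated.
  apply: iadd_min; first by apply/colonn_ideal/sat_ideal => //; exact/hA.
  + by apply: subset_trans hk _; exact: colonnS.
  + apply: principal_sub; first by apply/colonn_ideal/sat_ideal => //; exact/hA.
    by apply: sub_colonn => //; apply/sat_ideal => //; exact/hA.
(* Either [a] lies in every [J n] and adding it changes nothing, or [J n1] misses [a]. In the latter
   case, beyond [n1] only multiples of [a] by elements of [N] can occur, and these lie in [L]. *)
have [hall|/existsNP[n1 hn1]] := pselect (forall n, J n a).
  have e n : J' n = J n.
    apply/seteqP; split=> //; apply: sat_min; first exact: satJ.
    by apply: iadd_min => //; exact: principal_sub.
  by exists n0 => m hm; rewrite -!e; exact: hn0.
exists (maxn n0 n1) => m hm; set n := maxn n0 n1; apply/seteqP; split; first exact: decJ.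
move=> b hb.
have : J' m b.
  rewrite hn0; last by apply: leq_trans hm; exact: leq_maxl.
  by rewrite -(hn0 n (leq_maxl _ _)); exact: JJ'.
move=> [s [hs [c [_ [hc [r _ <-] e]]]]].
have har : J n (a * r).
  apply: (@ideal_addr _ _ c) => //; first exact: (decJ n m).
  by rewrite -e; exact: ideal_mull.
have hr : N r.
  apply: contrapT => hr; apply: hn1; apply: (decJ n1 n); first exact: leq_maxr.
  by apply: (satJ n r) => //; rewrite mulrC.
apply: (satJ m s) => //; rewrite e; apply: idealD => //.
by apply: hLJ; rewrite mulrC; exact: haN.
Qed.

(** For a descending chain this contains 1 exactly when the chain becomes stationary. *)
Definition eventual_conductor (J : nat -> set A) : set A :=
  [set c | exists n, forall m, (n <= m)%N -> forall a, J n a -> J m (c * a)].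

Section DescendingChain.
Variable J : nat -> set A.
Hypothesis hJ : forall n, ideal (J n).
Hypothesis decJ : forall m n, (m <= n)%N -> J n `<=` J m.

Lemma eventual_conductor_ideal : ideal (eventual_conductor J).
Proof.
split.
- by exists 0%N => m _ a _; rewrite mul0r; exact: ideal0.
- move=> x y [n hn] [n' hn']; exists (maxn n n') => m; rewrite geq_max => /andP[hm hm'] a ha.
  rewrite mulrDl; apply: idealD => //.
  + by apply: hn => //; apply: decJ ha; exact: leq_maxl.
  + by apply: hn' => //; apply: decJ ha; exact: leq_maxr.
- by move=> a x [n hn]; exists n => m hm b hb; rewrite -mulrA; apply: ideal_mull => //; exact: hn.
Qed.

(** The conductors [E n] valid from stage [n] on form an ascending chain of ideals, so one stage
    serves them all. *)
Lemma eventual_conductor_uniform : exists n, forall c, eventual_conductor J c ->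
  forall m, forall a, J n a -> J m (c * a).
Proof.
pose E n := [set c | forall m, (n <= m)%N -> forall a, J n a -> J m (c * a)].
have hE n : ideal (E n).
  split.
  - by move=> m _ a _; rewrite mul0r; exact: ideal0.
  - by move=> x y hx hy m hm a ha; rewrite mulrDl; apply: idealD => //; [exact: hx|exact: hy].
  - by move=> a x hx m hm b hb; rewrite -mulrA; apply: ideal_mull => //; exact: hx.
have incE n : E n `<=` E n.+1.
  by move=> c hc m hm a ha; apply: hc; [exact: ltnW|apply: decJ ha; exact: leqnSn].
have [n hn] := noeth_acc_sub noethA hE incE.
exists n => c [n' hn'] m a ha; have hc : E n c by exact: (hn n').
have [hm|hm] := leqP n m; first exact: hc.
by apply: ideal_mull => //; apply: decJ ha; exact: ltnW.
Qed.

(** A power of [N] lies in the conductor locally at [N], hence carries the chain from stage [n0] on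
    into its intersection; there [saturated_dcc] applies, and [uniform_denominator] turns equality
    at [N] into one factor [s]. *)
Lemma chain_stable_at N : minimal_over (eventual_conductor J) N ->
  exists n, forall m, (n <= m)%N ->
    exists2 s, ~ N s & forall a, J n a -> J m (s * a).
Proof.
move=> hmin; have [prN _] := hmin.
have [k hk] := minimal_over_colonn eventual_conductor_ideal hmin.
have [n0 hn0] := eventual_conductor_uniform.
pose L := sat N [set a | forall m, J m a].
have hL0 : ideal [set a | forall m, J m a] by exact: ideal_bigcap.
have [|||||||n hn] := @saturated_dcc N k L (fun i => sat N (J (n0 + i))) prN.
- exact: sat_ideal.
- exact: sat_saturated.
- by move=> n; exact: sat_ideal.
- by move=> n; exact: sat_saturated.
- by move=> n; apply: satS => a; exact.
- by move=> m n hmn; apply: satS; apply: decJ; rewrite leq_add2l.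
- apply: sat_min; first by apply: colonn_saturated; exact: sat_saturated.
  rewrite addn0 => a ha; rewrite -[a]mul1r; apply: colonn_mul hk.
  move=> d [s [hs hd]]; exists s; split=> // m; rewrite mulrA; exact: hn0.
- exists (n0 + n)%N => m hm; apply: uniform_denominator => //.
  have := hn (m - n0)%N; rewrite subnKC; last by apply: leq_trans hm; exact: leq_addr.
  rewrite leq_subRL; last by apply: leq_trans hm; exact: leq_addr.
  by move=> /(_ hm) ->; exact: sub_sat.
Qed.

End DescendingChain.
End PrimaryDecomposition.

(** * Krull's principal ideal theorem and regular local rings *)

Section KrullDimension.
Variable A : comNzRingType.
Hypothesis noethA : noetherian A.
Implicit Types (I J L C D N P Q m : set A) (x y a b s t c d : A).

Lemma ideal_exp_ideal I n : ideal (ideal_exp I n).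
Proof. by case: n => [|n]; [exact: ideal_setT|exact: ideal_gen_ideal]. Qed.

Lemma ideal_expS_sub I n : ideal I -> ideal_exp I n.+1 `<=` ideal_exp I n.
Proof.
move=> hI; apply: ideal_gen_min; first exact: ideal_exp_ideal.
by move=> _ [x [y [_ hy ->]]]; apply: ideal_mull => //; exact: ideal_exp_ideal.
Qed.

Lemma ideal_exp_X I n x : I x -> ideal_exp I n (x ^+ n).
Proof.
move=> hx; elim: n => [|n IH] //; rewrite exprS.
by apply: sub_ideal_gen; exists x, (x ^+ n).
Qed.

(* Krull's principal ideal theorem, via the symbolic powers [Qs n] of [Q] modulo [P]: if [N] were minimal
   over [P + (x)], then [Qs n + (x)] would stabilise at [N], so [Qs n = Qs n.+1] by Nakayama, whence
   [Q ^ n <= P] locally at [Q] by Nakayama again. *)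
Lemma krull_principal P Q N x :
  prime_ideal P -> prime_ideal Q -> prime_ideal N ->
  P `<` Q -> Q `<=` N -> N x -> ~ Q x ->
  exists Q', [/\ prime_ideal Q', P `<=` Q', Q' `<` N & Q' x].
Proof.
move=> prP prQ prN [hPQ hQP] hQN hNx hQx; apply: contrapT => hno.
have hP := prime_ideal_ideal prP; have hQ := prime_ideal_ideal prQ.
have hN := prime_ideal_ideal prN.
pose C := iadd P (principal x).
have hpx : ideal (principal x) by exact: principal_ideal.
have hC : ideal C by exact: iadd_ideal.
have minN : minimal_over C N.
  split=> // Q' prQ' hCQ' hQ'N; apply: contrapT => hne; apply: hno; exists Q'; split=> //.
  - by apply: subset_trans hCQ'; exact: iaddl.
  - by split=> // h; apply: hne; apply/seteqP.
  - by apply: hCQ'; apply: iaddr => //; exact: principal_id.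
have [k hk] := minimal_over_colonn noethA hC minN.
pose E n := iadd (ideal_exp Q n) P; pose Qs n := sat Q (E n).
have hE n : ideal (E n) by apply: iadd_ideal => //; exact: ideal_exp_ideal.
have hQs n : ideal (Qs n) by exact: sat_ideal.
have incE n : E n.+1 `<=` E n.
  apply: iadd_min => //; last by apply: iaddr; exact: ideal_exp_ideal.
  by apply: (subset_trans (ideal_expS_sub hQ)); exact: iaddl.
have PQs n : P `<=` Qs n.
  apply: (@subset_trans _ (E n)); last exact: sub_sat.
  by apply: iaddr; exact: ideal_exp_ideal.
have satQs n : saturated Q (Qs n) by exact: sat_saturated.
pose J n := sat N (iadd (Qs n) (principal x)).
have hQx' n : ideal (iadd (Qs n) (principal x)) by exact: iadd_ideal.
have [|||||||n hn] := @saturated_dcc A noethA N k (sat N C) J prN.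
- exact: sat_ideal.
- exact: sat_saturated.
- by move=> n; exact: sat_ideal.
- by move=> n; exact: sat_saturated.
- move=> n; apply: satS; apply: iadd_min => //; last exact: iaddr.
  by apply: subset_trans (PQs n) _; exact: iaddl.
- move=> i n /subnK <-; elim: (n - i)%N => [|j IH] //.
  rewrite addSn; apply: subset_trans IH; apply: satS.
  apply: iadd_min => //; last exact: iaddr.
  apply: (@subset_trans _ (Qs (j + i)%N)); last exact: iaddl.
  by apply: satS; exact: incE.
- move=> a _; rewrite -[a]mulr1; apply: ideal_mull => //.
  by apply: colonn_ideal; exact: sat_ideal.
have [||s hs hsn] := @uniform_denominator A noethA N (iadd (Qs n.+1) (principal x)) (Qs n) prN.
- exact: hQx'.
- rewrite -[sat N _]/(J n.+1) (hn n.+1) //.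
  apply: (@subset_trans _ (iadd (Qs n) (principal x))); last exact: sub_sat.
  exact: iaddl.
(* From $sa = b + xr$ with [b] in [Qs n.+1] and [x] outside [Q], saturation puts [r] in [Qs n], as
   Nakayama requires. *)
have [|||t ht htn] := @nakayama_principal A N (Qs n.+1) (Qs n) x s noethA _ prN hNx _ hs => //.
  move=> a ha; have [b [_ [hb [r _ <-] e]]] := hsn a ha.
  exists b, r; split=> //; apply: (satQs n x) => //.
  apply: (@ideal_addr _ _ b) => //; first exact: (satS (@incE n)).
  by rewrite -e; exact: ideal_mull.
have [||s' hs' hs'n] := @uniform_denominator A noethA Q (E n.+1) (ideal_exp Q n) prQ.
- exact: hE.
- move=> a ha; apply: (satQs n.+1 t); first by move=> /hQN.
  by apply: htn; apply: (sub_sat prQ); exact: iaddl.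
(* Locally at [Q] one now has $Q^n \subseteq Q \cdot Q^n + P$; hence $Q^n \subseteq P$ there, which
   is impossible as [P] is a prime strictly inside [Q]. *)
have [|||t' ht' ht'n] := @nakayama A Q Q P (ideal_exp Q n) s' noethA _ prQ hQ _ hP hs' => //.
- exact: ideal_exp_ideal.
- apply: hQP => q hq; apply: contrapT => hqP.
  have := ht'n _ (ideal_exp_X n hq).
  by apply: primeM => //; [move=> /hPQ|exact: primeX].
Qed.

Fixpoint chain_to m n P : Prop := prime_ideal P /\
  if n is n'.+1 then exists2 Q, P `<` Q & chain_to m n' Q else P = m.

Lemma chain_to_prime m n P : chain_to m n P -> prime_ideal P.
Proof. by case: n => [|n] []. Qed.

(** By induction the prime above [Q0] may be taken to contain [x]; then [krull_principal] replaces
    [Q0] by a prime containing [x]. The length of the chain is preserved. *)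
Lemma chain_through m n P x : chain_to m n.+1 P -> m x ->
  exists Q, [/\ P `<` Q, Q x & chain_to m n Q].
Proof.
elim: n P => [|n IH] P [prP [Q0 hPQ0 hQ0]] hx.
  by exists Q0; split=> //; case: hQ0 => _ ->.
have [Q1 [[h01 h10] hQ1x hQ1]] := IH Q0 hQ0 hx.
have [h|h] := pselect (Q0 x); first by exists Q0.
have [] := @krull_principal P Q0 Q1 x prP (proj1 hQ0) (chain_to_prime hQ1) hPQ0 h01 hQ1x h.
move=> Q' [prQ' hPQ' hQ'Q1 hQ'x]; exists Q'; split=> //.
  split=> // hQ'P; apply: h; apply: (proj1 hPQ0); exact: hQ'P.
by split=> //; exists Q1.
Qed.

Lemma chain_to_of_prime_chain n (c : nat -> set A) : prime_chain n c ->
  chain_to (c n) n (c 0%N).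
Proof.
elim: n c => [|n IH] c [hpr hlt].
  by split=> //; exact: hpr.
split; first exact: hpr.
exists (c 1%N); first exact: hlt.
by apply: (IH (fun i => c i.+1)); split=> i hi; [exact: hpr|exact: hlt].
Qed.

End KrullDimension.

(** * Regular systems of parameters *)

Section RegularLocal.
Variable A : comNzRingType.
Hypothesis noethA : noetherian A.
Variable m : set A.
Hypothesis prm : prime_ideal m.
Hypothesis unitm : forall x : A, ~ m x -> exists y, x * y = 1.
Implicit Types (I J L C D N P Q : set A) (x y a b s t c : A).

Definition add_gens I (l : seq A) : set A := foldl (fun I x => iadd I (principal x)) I l.

Lemma add_gens_ideal I l : ideal I -> ideal (add_gens I l).
Proof.
elim: l I => //= x l IH I hI; apply: IH; apply: iadd_ideal => //; exact: principal_ideal.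
Qed.

Lemma add_gens_min I l L : ideal L -> I `<=` L -> (forall x, x \in l -> L x) ->
  add_gens I l `<=` L.
Proof.
move=> hL; elim: l I => [|x l IH] I hI hl //=; apply: IH.
  apply: iadd_min => //; apply: principal_sub => //; apply: hl; exact: mem_head.
by move=> y hy; apply: hl; rewrite in_cons hy orbT.
Qed.

Lemma sub_add_gens I l : I `<=` add_gens I l.
Proof.
elim: l I => [|x l IH] I //=.
apply: (@subset_trans _ (iadd I (principal x))); last exact: IH.
by apply: iaddl; exact: principal_ideal.
Qed.

Lemma mem_add_gens I l x : ideal I -> x \in l -> add_gens I l x.
Proof.
elim: l I => //= y l IH I hI; rewrite in_cons => /orP[/eqP ->|hx].
  apply: sub_add_gens; apply: iaddr => //; exact: principal_id.
by apply: IH => //; apply: iadd_ideal => //; exact: principal_ideal.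
Qed.

Lemma local_nakayama I J x : ideal I -> ideal J -> m x ->
  (forall a, J a -> exists c b, [/\ I c, J b & a = c + x * b]) -> J `<=` I.
Proof.
move=> hI hJ hx h.
have [|t ht htJ] := @nakayama_principal A m I J x 1 noethA hJ prm hx hI (prime1 prm).
  by move=> a /h[c [b [hc hb ->]]]; exists c, b; rewrite mul1r.
move=> a ha; have [u hu] := unitm ht.
by rewrite -[a]mul1r -hu (mulrC t) -mulrA; apply: ideal_mull => //; exact: htJ.
Qed.

(** Each generator accounts for one step of the chain, so no room is left between [I] and [P]. By
    induction $I + (x)$ is the next prime [Q]; since [x] is outside the prime [P], this gives $P
    \subseteq I + xP$, and Nakayama concludes. *)
Lemma chain_start_eq l I P : ideal I -> m = add_gens I l -> I `<=` P ->
  chain_to m (size l) P -> I = P.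
Proof.
elim: l I P => [|x l IH] I P hI hm hIP hch; first by case: hch => _ ->; rewrite hm.
have hmx : m x by rewrite hm; apply: mem_add_gens => //; exact: mem_head.
have [Q [hPQ hQx hQ]] := chain_through noethA hch hmx.
have hP := prime_ideal_ideal (chain_to_prime hch).
have hQi := prime_ideal_ideal (chain_to_prime hQ).
have hQeq : iadd I (principal x) = Q.
  apply: IH => //; first by apply: iadd_ideal => //; exact: principal_ideal.
  apply: iadd_min => //; last exact: principal_sub.
  exact: subset_trans hIP (proj1 hPQ).
have hPx : ~ P x.
  move=> hPx; apply: (proj2 hPQ); rewrite -hQeq; apply: iadd_min => //; exact: principal_sub.
apply/seteqP; split=> //; apply: (@local_nakayama _ _ x) => // a ha.
have : Q a by exact: (proj1 hPQ).
rewrite -hQeq => -[c [_ [hc [b _ <-] e]]]; exists c, b; split=> //.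
have : P (x * b) by apply: (@ideal_addr _ _ c) => //; [exact: hIP|rewrite -e].
by case: (chain_to_prime hch) => _ _ h /h [].
Qed.

(** Following the chain, the ideal of the first parameters equals the prime reached. If it contained
    [x], that generator could be dropped, and [chain_start_eq] would identify two distinct primes of
    the chain. *)
Lemma parameters_prime l x l' I P : ideal I -> m = add_gens I (l ++ x :: l') ->
  I `<=` P -> chain_to m (size (l ++ x :: l')) P ->
  prime_ideal (add_gens I l) /\ ~ add_gens I l x.
Proof.
elim: l I P => [|y l IH] I P hI hm hIP hch /=.
  have eP := chain_start_eq hI hm hIP hch.
  split; first by rewrite eP; exact: chain_to_prime hch.
  have hmx : m x by rewrite hm; apply: mem_add_gens => //; exact: mem_head.
  have [Q [hPQ hQx hQ]] := chain_through noethA hch hmx.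
  move=> hIx; apply: (proj2 hPQ); rewrite -eP -(@chain_start_eq l' I Q) //.
  - rewrite {1}hm /=; congr add_gens; apply/seteqP; split.
      by apply: iadd_min => //; exact: principal_sub.
    by apply: iaddl; exact: principal_ideal.
  - exact: subset_trans hIP (proj1 hPQ).
have hmy : m y by rewrite hm; apply: mem_add_gens => //; exact: mem_head.
have [Q [hPQ hQy hQ]] := chain_through noethA hch hmy.
apply: (IH _ Q) => //; first by apply: iadd_ideal => //; exact: principal_ideal.
apply: iadd_min; first exact: prime_ideal_ideal (chain_to_prime hQ).
  exact: subset_trans hIP (proj1 hPQ).
by apply: principal_sub => //; exact: prime_ideal_ideal (chain_to_prime hQ).
Qed.

Definition gens (d : nat) (y : 'I_d -> A) (S : {set 'I_d}) : set A :=
  ideal_gen [set x | exists2 j, j \in S & x = y j].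

Lemma gens_ideal d (y : 'I_d -> A) (S : {set 'I_d}) : ideal (gens y S).
Proof. exact: ideal_gen_ideal. Qed.

Lemma mem_gens d (y : 'I_d -> A) (S : {set 'I_d}) j : j \in S -> gens y S (y j).
Proof. by move=> hj; apply: sub_ideal_gen; exists j. Qed.

Lemma gens_min d (y : 'I_d -> A) (S : {set 'I_d}) L : ideal L -> (forall j, j \in S -> L (y j)) ->
  gens y S `<=` L.
Proof. by move=> hL h; apply: ideal_gen_min => // _ [j hj ->]; exact: h. Qed.

Lemma gensU1 d (y : 'I_d -> A) (S : {set 'I_d}) i :
  gens y (i |: S)%SET = iadd (gens y S) (principal (y i)).
Proof.
have hg T := gens_ideal y T; have hp := principal_ideal (y i).
apply/seteqP; split.
  apply: gens_min; first exact: iadd_ideal.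
  move=> j; rewrite in_setU1 => /orP[/eqP ->|hj].
    by apply: iaddr => //; exact: principal_id.
  by apply: iaddl => //; exact: mem_gens.
apply: iadd_min => //.
  by apply: gens_min => // j hj; apply: mem_gens; rewrite in_setU1 hj orbT.
by apply: principal_sub => //; apply: mem_gens; rewrite setU11.
Qed.

Lemma eq_gens d (y z : 'I_d -> A) (S : {set 'I_d}) : (forall j, j \in S -> y j = z j) ->
  gens y S = gens z S.
Proof.
move=> h; apply/seteqP; split; apply: gens_min; try exact: gens_ideal.
  by move=> j hj; rewrite h //; exact: mem_gens.
by move=> j hj; rewrite -h //; exact: mem_gens.
Qed.

(* Every subfamily is a regular sequence, in every order. *)
Definition regular_family (d : nat) (y : 'I_d -> A) : Prop :=
  forall (S : {set 'I_d}) i z, i \notin S -> gens y S (y i * z) -> gens y S z.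

(** Induction on [k]: modulo [J], first write $z = uz'$, then cancel one factor [u] to find $wz' \in
    J + (u^k)$. *)
Lemma nonzerodivisor_modX J (u w : A) k : ideal J ->
  (forall z, J (u * z) -> J z) ->
  (forall z, iadd J (principal u) (w * z) -> iadd J (principal u) z) ->
  forall z, iadd J (principal (u ^+ k)) (w * z) -> iadd J (principal (u ^+ k)) z.
Proof.
move=> hJ hu hw; elim: k => [|k IH] z.
  by move=> _; apply: iaddr => //; exists z; rewrite ?expr0 ?mul1r.
move=> [j [_ [hj [r _ <-] e]]].
have [|j' [_ [hj' [z' _ <-] ez]]] := hw z.
  by exists j, (u ^+ k.+1 * r); split=> //; exists (u ^+ k * r) => //; rewrite exprS mulrA.
have hz' : iadd J (principal (u ^+ k)) (w * z').
  exists (w * z' - u ^+ k * r), (u ^+ k * r); split; last by rewrite subrK.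
    apply: hu.
    have -> : u * (w * z' - u ^+ k * r) = j - w * j'.
      have : j = w * z - u ^+ k.+1 * r by rewrite e addrK.
      by rewrite ez exprS => ->; ring.
    by apply: idealB => //; exact: ideal_mull.
  by exists r.
have [a [_ [ha [r' _ <-] ea]]] := IH _ hz'.
rewrite ez ea; exists (j' + u * a), (u ^+ k.+1 * r'); split.
- by apply: idealD => //; exact: ideal_mull.
- by exists r'.
- by rewrite exprS; ring.
Qed.

Lemma regular_family_powers d (y : 'I_d -> A) k : regular_family y ->
  regular_family (fun j => y j ^+ k.+1).
Proof.
(* The elements are raised to their powers one index at a time; [r] lists the indices already
   treated. *)
move=> hy; pose yr (r : seq 'I_d) j := if j \in r then y j ^+ k.+1 else y j.
suff h r : regular_family (yr r).
  have -> : (fun j => y j ^+ k.+1) = yr (enum 'I_d).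
    by apply/funext => j; rewrite /yr mem_enum.
  exact: h.
elim: r => [//|i0 r IH].
have [hi0|hi0] := boolP (i0 \in r).
  suff -> : yr (i0 :: r) = yr r by [].
  apply/funext => j; rewrite /yr in_cons; have [->|//] := eqVneq j i0.
  by rewrite hi0.
have y0 : yr (i0 :: r) i0 = yr r i0 ^+ k.+1 by rewrite /yr mem_head (negPf hi0).
have y1 j : j != i0 -> yr (i0 :: r) j = yr r j.
  by move=> hj; rewrite /yr in_cons (negPf hj).
move=> S i z hiS.
have [h0S|h0S] := boolP (i0 \in S); last first.
  have -> : gens (yr (i0 :: r)) S = gens (yr r) S.
    by apply: eq_gens => j hj; apply: y1; apply: contraNneq h0S => <-.
  have [ei|ni] := eqVneq i i0; last by rewrite y1 //; exact: IH.
  rewrite ei y0; rewrite ei in hiS => {ei}.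
  elim: k.+1 z => [|n IHn] z; first by rewrite expr0 mul1r.
  by rewrite exprS -mulrA => /(IH _ _ _ hiS) /IHn.
have ni : i != i0 by apply: contraNneq hiS => ->.
rewrite y1 // -(finset.setD1K h0S) gensU1 y0.
have -> : gens (yr (i0 :: r)) (S :\ i0)%SET = gens (yr r) (S :\ i0)%SET.
  by apply: eq_gens => j; rewrite finset.in_setD1 => /andP[hj _]; exact: y1.
apply: nonzerodivisor_modX; first exact: gens_ideal.
- by move=> u; apply: IH; rewrite finset.setD11.
- by move=> u; rewrite -gensU1 finset.setD1K //; exact: IH.
Qed.

(** List the parameters of [S] first, then [y i], then the others: by [parameters_prime] the ideal
    of [S] is prime and does not contain [y i]. *)
Lemma parameters_regular d (y : 'I_d -> A) P : m = ideal_gen (range y) ->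
  chain_to m d P -> regular_family y.
Proof.
move=> hm hch S i z hiS.
have h0 : ideal [set (0 : A)].
  split=> //.
  - by move=> _ _ -> ->; rewrite /= addr0.
  - by move=> a _ ->; rewrite /= mulr0.
pose T := (~: S :\ i)%SET.
pose l := [seq y j | j <- enum S]; pose l' := [seq y j | j <- enum T].
have eg : gens y S = add_gens [set 0] l.
  apply/seteqP; split.
    apply: gens_min; first exact: add_gens_ideal.
    by move=> j hj; apply: mem_add_gens => //; apply: map_f; rewrite mem_enum.
  apply: add_gens_min; first exact: gens_ideal.
    by move=> _ ->; apply: ideal0; exact: gens_ideal.
  by move=> _ /mapP[j hj ->]; apply: mem_gens; rewrite -mem_enum.
have hml : m = add_gens [set 0] (l ++ y i :: l').
  rewrite hm; apply/seteqP; split.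
    apply: ideal_gen_min; first exact: add_gens_ideal.
    move=> _ [j _ <-]; apply: mem_add_gens => //.
    rewrite mem_cat in_cons; have [hjS|hjS] := boolP (j \in S).
      by rewrite map_f // mem_enum.
    have [->|hji] := eqVneq j i; first by rewrite eqxx orbT.
    by rewrite (map_f y (s := enum T)) ?orbT // mem_enum finset.in_setD1 hji finset.in_setC.
  apply: add_gens_min; first exact: ideal_gen_ideal.
    by move=> _ ->; apply: ideal0; exact: ideal_gen_ideal.
  move=> x; rewrite mem_cat in_cons => hx.
  suff [j ->] : exists j, x = y j by apply: sub_ideal_gen; exists j.
  by case/orP: hx => [/mapP[j _ ->]|/orP[/eqP ->|/mapP[j _ ->]]]; [exists j|exists i|exists j].
have hsz : size (l ++ y i :: l') = d.
  rewrite size_cat /= !size_map -!cardE addnS -addSn.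
  have hc := cardsC S; rewrite (cardsD1 i (~: S)%SET) finset.in_setC hiS card_ord in hc.
  by rewrite -[RHS]hc /= add1n addnS.
have [] := @parameters_prime l (y i) l' [set 0] P h0 hml.
- by move=> _ ->; exact: ideal0 (prime_ideal_ideal (chain_to_prime hch)).
- by rewrite hsz.
- by rewrite eg => -[_ _ hpr] hi /hpr [].
Qed.

End RegularLocal.

(** * Freeness of Frobenius *)

Section FrobeniusFree.
Variables (A : comNzRingType) (p : nat).
Hypothesis charAp : p \in [pchar A].
Implicit Types (x y a b c : A).

Lemma frobD x y : (x + y) ^+ p = x ^+ p + y ^+ p.
Proof. by rewrite -!(pFrobenius_autE charAp) rmorphD. Qed.
Lemma frobB x y : (x - y) ^+ p = x ^+ p - y ^+ p.
Proof. by rewrite -!(pFrobenius_autE charAp) rmorphB. Qed.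
Lemma frob0 : (0 : A) ^+ p = 0.
Proof. by rewrite -(pFrobenius_autE charAp) rmorph0. Qed.
Lemma frob_sum (T : Type) (r : seq T) (Pr : pred T) (F : T -> A) :
  (\sum_(i <- r | Pr i) F i) ^+ p = \sum_(i <- r | Pr i) F i ^+ p.
Proof. exact: (big_morph (fun x : A => x ^+ p) frobD frob0). Qed.

Definition frob_generating n (h : 'I_n -> A) : Prop :=
  forall b, exists c : 'I_n -> A, b = \sum_i c i ^+ p * h i.

Hypothesis noethA : noetherian A.
Variable m : set A.
Hypothesis prm : prime_ideal m.
Hypothesis unitm : forall x : A, ~ m x -> exists y, x * y = 1.
Variables (d : nat) (y : 'I_d -> A).
Hypothesis my : m = ideal_gen (range y).
Variables (n : nat) (h : 'I_n -> A).
Hypothesis genh : frob_generating h.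
Hypothesis minh : forall i : 'I_n, ~ frob_generating (fun j : 'I_n.-1 => h (lift i j)).

Let yp j := y j ^+ p.

Lemma minimal_frob_relation (a : 'I_n -> A) i :
  gens yp [set: 'I_d]%SET (\sum_i a i ^+ p * h i) -> m (a i).
Proof.
move=> ha; apply: contrapT => hai.
have [v [hv ev]] : exists v : 'I_n -> A, (forall i, m (v i)) /\
    \sum_i a i ^+ p * h i = \sum_i v i ^+ p * h i.
  have hm := prime_ideal_ideal prm; 
  pose L : set A := [set z | exists v : 'I_n -> A, (forall i, m (v i)) /\
    z = \sum_i v i ^+ p * h i].
  suff hL : ideal L.
    suff : gens yp [set: 'I_d]%SET `<=` L by apply.
    apply: gens_min => // j _; have [c hc] := genh 1.
    exists (fun i => y j * c i); split.
      move=> k; apply: ideal_mulr => //; rewrite my; apply: sub_ideal_gen.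
      by exists j.
    rewrite -[yp j]mulr1 [in LHS]hc mulr_sumr; apply: eq_bigr => k _.
    by rewrite exprMn mulrA.
  split.
  - exists (fun=> 0); split; first by move=> _; exact: ideal0.
    by rewrite big1 // => k _; rewrite frob0 mul0r.
  - move=> _ _ [v [hv ->]] [w [hw ->]]; exists (fun i => v i + w i).
    split; first by move=> k; exact: idealD.
    by rewrite -big_split; apply: eq_bigr => k _; rewrite frobD mulrDl.
  - move=> b _ [v [hv ->]].
    have /choice[e he] : forall k, exists e : 'I_n -> A, b * h k = \sum_i e i ^+ p * h i.
      by move=> k; exact: genh.
    exists (fun i => \sum_k v k * e k i); split.
      by move=> k; apply: ideal_sum => // k' _; exact: ideal_mulr.
    rewrite mulr_sumr.
    under eq_bigr => k _ do rewrite mulrCA he mulr_sumr.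
    rewrite exchange_big; apply: eq_bigr => k _.
    rewrite frob_sum mulr_suml; apply: eq_bigr => k' _.
    by rewrite exprMn mulrA.
pose w j := a j - v j.
have ew : \sum_i w i ^+ p * h i = 0.
  under eq_bigr do rewrite frobB mulrBl.
  by rewrite sumrB ev subrr.
have [|u hu] := @unitm (w i).
  move=> hwi; apply: hai; rewrite -(subrK (v i) (a i)).
  by apply: idealD => //; exact: prime_ideal_ideal prm.
have hhi : h i = - \sum_j (u * w (lift i j)) ^+ p * h (lift i j).
  move: ew; rewrite (bigD1_ord i) //= => /eqP; rewrite addr_eq0 => /eqP e.
  have -> : h i = u ^+ p * (w i ^+ p * h i).
    by rewrite mulrA -exprMn (mulrC u) hu expr1n mul1r.
  rewrite e mulrN mulr_sumr; congr (- _); apply: eq_bigr => j _.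
  by rewrite exprMn mulrA.
apply: (@minh i) => b; have [c ->] := genh b.
exists (fun j => c (lift i j) - c i * (u * w (lift i j))).
rewrite (bigD1_ord i) //= hhi mulrN mulr_sumr addrC -sumrB; apply: eq_bigr => j _.
by rewrite frobB mulrBl [in RHS]exprMn mulrA.
Qed.

Hypothesis regy : regular_family y.

(* Descent on the set of parameters: dividing out [y i] is harmless because [y i ^+ p] is a nonzerodivisor
   modulo the other [p]-th powers, and Nakayama applies to the ideal of the [i]-th coordinates. *)
Lemma frob_relation_gens (S : {set 'I_d}) (a : 'I_n -> A) i :
  gens yp S (\sum_i a i ^+ p * h i) -> gens y S (a i).
Proof.
have p_gt0 : (0 < p)%N := prime_gt0 (pcharf_prime charAp).
have regyp : regular_family yp.
  by rewrite /yp -(prednK p_gt0); exact: regular_family_powers.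
have hm := prime_ideal_ideal prm.
have [k] := ubnP #|~: S|; elim: k S a i => // k IH S a i hk ha.
have [e0|[j]] := set_0Vmem (~: S).
  have eS : S = [set: 'I_d]%SET by rewrite -(finset.setCK S) e0 finset.setC0.
  have : m (a i) by apply: minimal_frob_relation; rewrite -eS.
  suff -> : m = gens y S by [].
  rewrite my eS; apply/seteqP; split.
    by apply: ideal_genS => _ [j _ <-]; exists j.
  by apply: ideal_genS => _ [j _ ->]; exists j.
rewrite finset.in_setC => hj.
pose K : set A := [set x | exists2 v : 'I_n -> A, gens yp S (\sum_i v i ^+ p * h i) & x = v i].
have gi (z : 'I_d -> A) := gens_ideal z S; have hKi : ideal K.
  split.
  - exists (fun=> 0) => //; rewrite big1 => [|l _]; last by rewrite frob0 mul0r.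
    exact: (ideal0 (gens_ideal yp S)).
  - move=> _ _ [v hv ->] [w hw ->]; exists (fun i => v i + w i) => //.
    under eq_bigr do rewrite frobD mulrDl.
    by rewrite big_split; exact: idealD.
  - move=> b _ [v hv ->]; exists (fun i => b * v i) => //.
    under eq_bigr do rewrite exprMn -mulrA.
    by rewrite -mulr_sumr; exact: ideal_mull.
have myj : m (y j) by rewrite my; apply: sub_ideal_gen; exists j.
suff hK : K `<=` gens y S by apply: hK; exists a.
apply: (@local_nakayama A noethA m prm unitm _ _ (y j)) => // _ [v hv ->].
(* The induction hypothesis for [S] enlarged by [j] splits every coordinate into a part in
   [gens y S] and a multiple of [y j]. *)
have /choice[b hb] (l : 'I_n) : exists b : A * A, gens y S b.1 /\ v l = b.1 + y j * b.2.
  have : gens y (j |: S)%SET (v l).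
    apply: IH.
      rewrite finset.setCU -ltnS; apply: leq_trans hk; rewrite ltnS.
      apply: proper_card; apply/properP; split; first exact: subsetIr.
      by exists j; rewrite !inE ?eqxx.
    by rewrite gensU1; apply: iaddl hv; exact: principal_ideal.
  by rewrite gensU1 => -[c [_ [hc [r _ <-] ->]]]; exists (c, r).
exists (b i).1, (b i).2; split; [exact: (proj1 (hb i))| |exact: (proj2 (hb i))].
exists (fun l => (b l).2) => //; apply: (regyp S j) => //.
rewrite mulr_sumr; apply: (@ideal_addr _ _ (\sum_l (b l).1 ^+ p * h l)) => //.
  apply: ideal_sum => // l _; apply: ideal_mulr => //.
  suff : gens y S `<=` [set x | gens yp S (x ^+ p)] by apply; exact: (proj1 (hb l)).
  apply: gens_min => [|j' hj']; last exact: mem_gens.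
  split => /=.
  - by rewrite frob0; exact: ideal0.
  - by move=> x1 x2 h1 h2; rewrite /= frobD; exact: idealD.
  - by move=> c x1 h1; rewrite /= exprMn; exact: ideal_mull.
rewrite -big_split /=; move: hv; congr (gens _ _ _); apply: eq_bigr => l _.
by rewrite (proj2 (hb l)) frobD exprMn mulrDl mulrA.
Qed.

Lemma frob_free (a : 'I_n -> A) i : \sum_i a i ^+ p * h i = 0 -> a i = 0.
Proof.
move=> ha; have : gens y finset.set0 (a i).
  by apply: frob_relation_gens; rewrite ha; exact: ideal0 (gens_ideal _ _).
suff : gens y finset.set0 `<=` [set 0] by apply.
apply: gens_min; last by move=> j; rewrite inE.
split=> //.
- by move=> _ _ -> ->; rewrite /= addr0.
- by move=> c _ ->; rewrite /= mulr0.
Qed.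

Lemma frob_coord_unique (a b : 'I_n -> A) :
  \sum_i a i ^+ p * h i = \sum_i b i ^+ p * h i -> a = b.
Proof.
move=> e; apply/funext => i; apply/eqP; rewrite -subr_eq0; apply/eqP.
apply: (frob_free (a := fun i => a i - b i)).
by under eq_bigr do rewrite frobB mulrBl; rewrite sumrB e subrr.
Qed.

End FrobeniusFree.

Section LocalRings.
Variable B : comNzRingType.
Hypothesis noethB : noetherian B.
Variable m : set B.
Hypothesis locm : local_ring_at m.

Lemma proper_sub_local I : ideal I -> ~ I 1 -> I `<=` m.
Proof.
by move=> hI h1; have [M [/(proj2 locm) -> hIM]] := noeth_exists_maximal noethB hI h1.
Qed.

Lemma local_unit (x : B) : ~ m x -> exists y, x * y = 1.
Proof.
move=> hx; have [[y _ <-]|h1] := pselect (principal x 1); first by exists y.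
by case: hx; apply: (proper_sub_local (principal_ideal x) h1); exact: principal_id.
Qed.

(** In a chain of maximal length the top prime may be replaced by [m], which contains every proper
    ideal. *)
Lemma krull_dim_chain_to n : krull_dim B n -> exists P, chain_to m n P.
Proof.
move=> [[c [hpr hlt]] _]; pose c' i := if i == n then m else c i.
have prm : prime_ideal m := maximal_prime (proj1 locm).
exists (c' 0%N); have -> : chain_to m = chain_to (c' n) by rewrite /c' eqxx.
apply: chain_to_of_prime_chain; split=> i hi; rewrite /c'.
  by have [_|_] := eqVneq i n; [|exact: hpr].
rewrite (ltn_eqF hi); have [e|_] := eqVneq i.+1 n; last exact: hlt.
have [h1 h2] := hlt i hi; have [hI hI1 _] := hpr i.+1 hi.
have hcm := proper_sub_local hI hI1.
split; first exact: subset_trans hcm.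
by move=> h; apply: h2; exact: subset_trans h.
Qed.

End LocalRings.

(** * Projectivity of Frobenius, from local to global *)

Section FrobeniusProjective.
Variables (R : comNzRingType) (p : nat).
Hypothesis charRp : p \in [pchar R].

Lemma F_finite_generating : F_finite charRp ->
  exists n (g : 'I_n -> R), frob_generating p g.
Proof. by move=> [n [g hg]]; exists n, g => x; have [a ->] := hg x; exists a. Qed.

(** The $p^{-1}$-linear maps, that is, the $R$-linear maps $F_*R \to R$. *)
Definition frob_linear (f : R -> R) : Prop :=
  (forall x y, f (x + y) = f x + f y) /\ (forall a x, f (a ^+ p * x) = a * f x).

(** Multiplication by [s] on $F_*R$ factors through a finite free module; for [s] equal to 1 this is
    a dual basis, hence projectivity of $F_*R$. *)
Definition frob_split (s : R) : Prop :=
  exists (T : finType) (f : T -> R -> R) (u : T -> R), (forall j, frob_linear (f j)) /\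
    forall b, s ^+ p * b = \sum_j f j b ^+ p * u j.

(** Concatenating two families adds their scalars. Being an ideal, this set is the whole ring once
    it is contained in no maximal ideal. *)
Lemma frob_split_ideal : ideal [set s | frob_split s].
Proof.
split.
- exists void, (fun _ _ => 0), (fun _ => 0); split; first by case.
  by move=> b; rewrite frob0 // mul0r big1 // => [] [].
- move=> s t [T [f [u [hf hs]]]] [U [g [v [hg ht]]]].
  exists (T + U)%type.
  exists (fun j => match j with inl i => f i | inr i => g i end).
  exists (fun j => match j with inl i => u i | inr i => v i end).
  split; first by case.
  by move=> b; rewrite frobD // mulrDl hs ht big_sumType.
- move=> a s [T [f [u [hf hs]]]]; exists T, (fun j b => a * f j b), u; split.
    move=> j; have [h1 h2] := hf j; split=> [x y|c x]; first by rewrite h1 mulrDr.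
    by rewrite h2 mulrCA.
  move=> b; rewrite exprMn -mulrA hs mulr_sumr; apply: eq_bigr => j _.
  by rewrite exprMn mulrA.
Qed.

Section Local.
Variables (B : comNzRingType) (phi : {rmorphism R -> B}) (m : set R).
Hypothesis prm : prime_ideal m.
Hypothesis locB : is_localization_at phi m.

Lemma common_denominator (T : finType) (x : T -> B) :
  exists2 s, ~ m s & exists a : T -> R, forall t, x t * phi s = phi (a t).
Proof.
have [_ frac _] := locB.
have /choice[s hs] t : exists s, ~ m s /\ exists a, x t * phi s = phi a.
  by have [a [s [h1 h2]]] := frac (x t); exists s; split=> //; exists a.
have /choice[a ha] t := proj2 (hs t).
exists (\prod_t s t); first by apply: prime_prod => // t _; exact: (proj1 (hs t)).
exists (fun t => a t * \prod_(i | i != t) s i) => t.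
by rewrite (bigD1 t) //= !rmorphM mulrA ha.
Qed.

Hypothesis noethR : noetherian R.
Hypothesis FfinR : F_finite charRp.

Lemma local_frob_generating : exists n (h : 'I_n -> R),
  frob_generating p (fun i => phi (h i)).
Proof.
have [inv frac _] := locB; have [n [g hg]] := F_finite_generating FfinR.
have p_gt0 : (0 < p)%N := prime_gt0 (pcharf_prime charRp).
exists n, g => b; have [a [s [hs e]]] := frac b; have [t ht] := inv s hs.
have [c hc] := hg (a * s ^+ p.-1).
exists (fun i => phi (c i) * t).
(* The fraction $a/s$ is rewritten as $a s^{p-1}/s^p$, so that its denominator is a $p$-th power. *)
have -> : b = phi (a * s ^+ p.-1) * t ^+ p.
  rewrite rmorphM rmorphXn -e -(mulrA b) -exprS prednK // -mulrA -exprMn ht.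
  by rewrite expr1n mulr1.
rewrite hc rmorph_sum mulr_suml; apply: eq_bigr => i _.
by rewrite rmorphM rmorphXn exprMn; ring.
Qed.

(** A minimal generating family over the local ring is a basis, so its coordinate functions are
    $p^{-1}$-linear; clearing denominators brings them back to [R]. *)
Lemma local_frob_split : regular_local_ring B -> exists2 s, ~ m s & frob_split s.
Proof.
move=> [noethB [mB [locmB [d [dimB [y hy]]]]]].
have charBp : p \in [pchar B] := rmorph_pchar phi charRp.
have prmB := maximal_prime (proj1 locmB).
have unitB := local_unit noethB locmB.
have [P hch] := krull_dim_chain_to noethB locmB dimB.
have regy := parameters_regular noethB prmB unitB hy hch.
(* Minimality is taken among families coming from [R], because the final identity must use elements
   of [R]. *)
have exn : exists n, `[< exists h : 'I_n -> R, frob_generating p (fun i => phi (h i)) >].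
  by have [n hn] := local_frob_generating; exists n; apply/asboolP.
case: (ex_minnP exn) => n /asboolP[h genh] minn.
have minh (i : 'I_n) : ~ frob_generating p (fun j : 'I_n.-1 => phi (h (lift i j))).
  move=> hi; have /minn : `[< exists h : 'I_n.-1 -> R, frob_generating p (fun i => phi (h i)) >].
    by apply/asboolP; exists (fun j => h (lift i j)).
  by rewrite leqNgt ltn_predL (leq_ltn_trans _ (ltn_ord i)).
have uniq := frob_coord_unique charBp noethB prmB unitB hy genh minh regy.
have [N [g hg]] := F_finite_generating FfinR.
have /choice[al hal] x := hg x.
have /choice[c hc] i := genh (phi (g i)).
have [S hS [r hr]] := common_denominator (fun ij : 'I_N * 'I_n => c ij.1 ij.2).
(* [f0] depends on the chosen expansion [al x], so it is known to be $p^{-1}$-linear only modulo the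
   kernel of [phi]; the factor [t] below kills that kernel. *)
pose f0 j x := \sum_i al x i * r (i, j).
pose co x j := \sum_i phi (al x i) * c i j.
have f0E x j : phi (f0 j x) = phi S * co x j.
  rewrite /co rmorph_sum mulr_sumr; apply: eq_bigr => i _.
  by rewrite rmorphM -(hr (i, j)) /=; ring.
have coE x : phi x = \sum_j co x j ^+ p * phi (h j).
  rewrite {1}(hal x) rmorph_sum.
  under eq_bigr => i _ do rewrite rmorphM hc mulr_sumr rmorphXn.
  rewrite exchange_big; apply: eq_bigr => j _.
  rewrite /co frob_sum // mulr_suml; apply: eq_bigr => i _.
  by rewrite exprMn mulrA.
have coD x z : co (x + z) = fun j => co x j + co z j.
  apply: uniq; rewrite -coE rmorphD !coE -big_split; apply: eq_bigr => j _.
  by rewrite frobD // mulrDl.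
have coM a x : co (a ^+ p * x) = fun j => phi a * co x j.
  apply: uniq; rewrite -coE rmorphM rmorphXn (coE x) mulr_sumr; apply: eq_bigr => j _.
  by rewrite exprMn mulrA.
pose ker : set R := [set x | phi x = 0].
have [_ _ loc0] := locB.
have h0 : ideal [set (0 : R)].
  split=> //.
  - by move=> _ _ -> ->; rewrite /= addr0.
  - by move=> a _ ->; rewrite /= mulr0.
have [|t ht hker] := @uniform_denominator R noethR m [set 0] ker prm h0.
  by move=> x /loc0[s [hs e]]; exists s.
have p_gt0 : (0 < p)%N := prime_gt0 (pcharf_prime charRp).
exists (t * S); first exact: primeM.
exists 'I_n, (fun j x => t * f0 j x), h; split.
  move=> j; split=> [x z|a x].
    apply/eqP; rewrite -subr_eq0 -mulrDr -mulrBr; apply/eqP; apply: hker.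
    by rewrite /ker /= rmorphB rmorphD !f0E coD mulrDr subrr.
  apply/eqP; rewrite -subr_eq0 mulrCA -mulrBr; apply/eqP; apply: hker.
  by rewrite /ker /= rmorphB rmorphM !f0E coM; ring.
move=> b; apply/eqP; rewrite -subr_eq0; apply/eqP.
under eq_bigr do rewrite exprMn -mulrA.
rewrite exprMn -mulrA -mulr_sumr -mulrBr -(prednK p_gt0) exprSr -mulrA.
rewrite prednK // hker ?mulr0 // /ker /= rmorphB rmorphM rmorph_sum (coE b) mulr_sumr.
apply/eqP; rewrite subr_eq0; apply/eqP; apply: eq_bigr => j _.
by rewrite rmorphM !rmorphXn f0E exprMn mulrA.
Qed.

End Local.

(** Otherwise the ideal of the [s] with [frob_split s] lies in a maximal ideal, at which
    [local_frob_split] supplies an element outside. *)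
Lemma regular_frob_split : regular_ring R -> F_finite charRp -> frob_split 1.
Proof.
move=> [noethR regR] FfinR; apply: contrapT => h1.
have [M [maxM hM]] := noeth_exists_maximal noethR frob_split_ideal h1.
have prM := maximal_prime maxM.
have [B [phi [locB regB]]] := regR M prM.
have [s hs /hM] := local_frob_split prM locB noethR FfinR regB.
exact: hs.
Qed.

End FrobeniusProjective.

(** * Frobenius roots and test ideals *)

Section NatCeil.
Variable K : realType.
Implicit Types x y : K.

Definition nceil x : nat := `|Num.ceil x|%N.

Lemma nceilE x : 0 <= x -> (nceil x)%:Z = Num.ceil x.
Proof. by move=> hx; rewrite /nceil gez0_abs // ceil_ge0 (lt_le_trans _ hx) // ltrN10. Qed.

Lemma nceil_le x n : 0 <= x -> (nceil x <= n)%N = (x <= n%:R).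
Proof. by move=> hx; rewrite -lez_nat nceilE // ceil_le_int. Qed.

Lemma nceil_ge x : 0 <= x -> x <= (nceil x)%:R.
Proof. by move=> hx; rewrite -nceil_le. Qed.

Lemma le_nceil x y : 0 <= x -> x <= y -> (nceil x <= nceil y)%N.
Proof. by move=> hx hxy; rewrite nceil_le // (le_trans hxy) // nceil_ge // (le_trans hx). Qed.

Lemma nceilD n x : 0 <= x -> nceil (n%:R + x) = (n + nceil x)%N.
Proof.
move=> hx; have hx' : 0 <= n%:R + x by rewrite addr_ge0.
apply/eqP; rewrite -eqz_nat nceilE // PoszD nceilE // pmulrn.
by rewrite ceilDzr ?intr_int // intrKceil.
Qed.

End NatCeil.

Section FrobeniusRoots.
Variables (R : comNzRingType) (p : nat).
Hypothesis charRp : p \in [pchar R].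
Variables (T : finType) (g : T -> R -> R) (u : T -> R).
Hypothesis linear_g : forall j, frob_linear p (g j).
Hypothesis dual_basis : forall b, b = \sum_j g j b ^+ p * u j.
Implicit Types (I J : set R) (e : nat).

Definition frobenius_root I : set R := ideal_gen [set x | exists j b, I b /\ x = g j b].
Definition iter_root e I : set R := iter e frobenius_root I.

Lemma frobenius_root_ideal I : ideal (frobenius_root I). Proof. exact: ideal_gen_ideal. Qed.

Lemma iter_root_ideal e I : ideal I -> ideal (iter_root e I).
Proof. by move=> hI; case: e => [//|e]; exact: frobenius_root_ideal. Qed.

Lemma frob_linear0 j : g j 0 = 0.
Proof. by have [h _] := linear_g j; apply: (addrI (g j 0)); rewrite -h !addr0. Qed.

Lemma frob_power_ideal J e : ideal (frob_power p J e).
Proof. exact: ideal_gen_ideal. Qed.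

Lemma frob_power0 J : ideal J -> frob_power p J 0 = J.
Proof.
move=> hJ; apply/seteqP; split.
  by apply: ideal_gen_min => // _ [v hv ->]; rewrite expn0 expr1.
by move=> v hv; apply: sub_ideal_gen; exists v; rewrite ?expn0 ?expr1.
Qed.

Lemma mem_frob_power1 J a b : J a -> frob_power p J 1 (b * a ^+ p).
Proof.
move=> ha; apply: ideal_mull; first exact: frob_power_ideal.
by apply: sub_ideal_gen; exists a; rewrite ?expn1.
Qed.

Lemma frob_powerS J e : frob_power p J e.+1 = frob_power p (frob_power p J e) 1.
Proof.
apply/seteqP; split.
  apply: ideal_gen_min; first exact: frob_power_ideal.
  move=> _ [v hv ->]; apply: sub_ideal_gen; exists (v ^+ (p ^ e)).
    by apply: sub_ideal_gen; exists v.
  by rewrite -exprM expn1 -expnSr.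
apply: ideal_gen_min; first exact: frob_power_ideal.
move=> _ [v hv ->]; rewrite expn1.
suff : frob_power p J e `<=` [set v | frob_power p J e.+1 (v ^+ p)] by apply.
have h1 := frob_power_ideal J e.+1; apply: ideal_gen_min.
  split=> /=.
  - by rewrite frob0 //; exact: ideal0.
  - by move=> x y hx hy; rewrite /= frobD //; exact: idealD.
  - by move=> a x hx; rewrite /= exprMn; exact: ideal_mull.
move=> _ [w hw ->]; apply: sub_ideal_gen; exists w => //.
by rewrite -exprM -expnSr.
Qed.

(** One direction applies $g_j(b a^p) = a g_j(b)$, the other expands an element in the dual basis.
    This adjunction identifies [frobenius_root I] with $I^{[1/p]}$. *)
Lemma sub_frob_power1 I J : ideal J -> (I `<=` frob_power p J 1) <-> (frobenius_root I `<=` J).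
Proof.
move=> hJ; split=> h.
  apply: ideal_gen_min => // _ [j [b [/h hb ->]]].
  suff : frob_power p J 1 `<=` [set b | J (g j b)] by apply.
  have [gD gM] := linear_g j => b' [n [a [s [hs ->]]]] /=.
  elim/big_ind: _ => [|x y hx hy|i _].
  - by rewrite frob_linear0; exact: ideal0.
  - by rewrite gD; exact: idealD.
  - have [v hv ->] := hs i.
    by rewrite expn1 mulrC gM; exact: ideal_mulr.
move=> b hb; rewrite [b]dual_basis; apply: ideal_sum; first exact: frob_power_ideal.
move=> j _; rewrite mulrC; apply: mem_frob_power1; apply: h.
by apply: sub_ideal_gen; exists j, b.
Qed.

Lemma sub_frob_power e I J : ideal J -> (I `<=` frob_power p J e) <-> (iter_root e I `<=` J).
Proof.
elim: e I => [|e IH] I hJ; first by rewrite frob_power0.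
rewrite frob_powerS sub_frob_power1; last exact: frob_power_ideal.
by rewrite /iter_root iterSr; exact: IH.
Qed.

Lemma frob_rootE e I : ideal I -> frob_root p I e = iter_root e I.
Proof.
move=> hI; apply: xget_subset1.
  split; first exact: iter_root_ideal.
  - by apply/sub_frob_power => //; exact: iter_root_ideal.
  - by move=> J hJ /sub_frob_power; exact.
move=> J J' [hJ hIJ hmin] [hJ' hIJ' hmin'].
by apply/seteqP; split; [exact: hmin|exact: hmin'].
Qed.

Lemma iter_rootS e I J : I `<=` J -> iter_root e I `<=` iter_root e J.
Proof.
move=> h; elim: e => [//|e IH]; apply: ideal_genS => _ [j [b [/IH hb ->]]].
by exists j, b.
Qed.

Lemma frobenius_root_scale c I : ideal I -> frobenius_root (scale (c ^+ p) I) = scale c (frobenius_root I).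
Proof.
move=> hI; have hs := scale_ideal c (frobenius_root_ideal I); apply/seteqP; split.
  apply: ideal_gen_min => // _ [j [_ [[b hb <-] ->]]].
  have [_ ->] := linear_g j; exists (g j b) => //; apply: sub_ideal_gen.
  by exists j, b.
move=> _ [x hx <-].
suff : frobenius_root I `<=` [set x | frobenius_root (scale (c ^+ p) I) (c * x)] by apply.
have h1 := frobenius_root_ideal (scale (c ^+ p) I); apply: ideal_gen_min.
  split=> /=.
  - by rewrite mulr0; exact: ideal0.
  - by move=> y z hy hz; rewrite /= mulrDr; exact: idealD.
  - by move=> a y hy; rewrite /= mulrCA; exact: ideal_mull.
move=> _ [j [b [hb ->]]] /=; apply: sub_ideal_gen; exists j, (c ^+ p * b).
by split; [exists b|have [_ ->] := linear_g j].
Qed.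

Lemma iter_root_scale e c I : ideal I -> iter_root e (scale (c ^+ (p ^ e)) I) = scale c (iter_root e I).
Proof.
elim: e I => [|e IH] I hI; first by rewrite expn0 expr1.
by rewrite /iter_root !iterSr expnSr exprM frobenius_root_scale //; exact: IH (frobenius_root_ideal I).
Qed.

Lemma frobenius_root_setT : frobenius_root setT = setT.
Proof.
apply: ideal_eqT; first exact: frobenius_root_ideal.
rewrite [1]dual_basis; apply: ideal_sum; first exact: frobenius_root_ideal.
move=> j _; have p_gt0 := prime_gt0 (pcharf_prime charRp).
rewrite -(prednK p_gt0) exprSr -mulrA; apply: ideal_mull; first exact: frobenius_root_ideal.
apply: ideal_mulr; first exact: frobenius_root_ideal.
by apply: sub_ideal_gen; exists j, 1.
Qed.

Lemma iter_rootD e e' I : iter_root (e + e') I = iter_root e (iter_root e' I).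
Proof. exact: iterD. Qed.

(** * Test ideals of a principal ideal *)

Section TestIdeal.
Variables (K : realType) (f : R).
Hypothesis noethR : noetherian R.
Implicit Types lam mu : K.

Lemma ideal_exp_principal n : ideal_exp (ideal_gen [set f]) n = principal (f ^+ n).
Proof.
elim: n => [|n IH]; first by rewrite expr0 /principal scale1.
rewrite /ideal_exp iterS -/(ideal_exp _ n) IH; apply/seteqP; split.
  apply: ideal_gen_min; first exact: principal_ideal.
  move=> _ [x [_ [hx [a _ <-] ->]]].
  have [b _ <-] : principal f x.
    suff : ideal_gen [set f] `<=` principal f by apply.
    apply: ideal_gen_min; first exact: principal_ideal.
    by move=> _ ->; exact: principal_id.
  by exists (b * a) => //; rewrite exprS; ring.
apply: principal_sub; first exact: ideal_gen_ideal.
rewrite exprS; apply: sub_ideal_gen; exists f, (f ^+ n); split=> //.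
  by apply: sub_ideal_gen.
exact: principal_id.
Qed.

Definition approx lam e : set R := iter_root e (principal (f ^+ nceil (lam * (p ^ e)%:R))).

Lemma test_ideal_approxE lam e :
  test_ideal_approx p (ideal_gen [set f]) lam e = approx lam e.
Proof. by rewrite /test_ideal_approx ideal_exp_principal frob_rootE //; exact: principal_ideal. Qed.

Lemma principalXS m n : (m <= n)%N -> principal (f ^+ n) `<=` principal (f ^+ m).
Proof.
move=> /subnK <-; apply: principal_sub; first exact: principal_ideal.
by rewrite addnC exprD; exists (f ^+ (n - m)).
Qed.

Lemma approx_ideal lam e : ideal (approx lam e).
Proof. by apply: iter_root_ideal; exact: principal_ideal. Qed.

Lemma approx_antitone lam mu e : 0 <= lam -> lam <= mu -> approx mu e `<=` approx lam e.
Proof.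
move=> h0 h; apply: iter_rootS; apply: principalXS; apply: le_nceil.
  by rewrite mulr_ge0.
by rewrite ler_wpM2r.
Qed.

(** Combine $(f^n) = (f^{pn})^{[1/p]}$ with $\lceil \lambda p^{e+1} \rceil \le p \lceil \lambda p^e
    \rceil$. *)
Lemma approx_increasing lam e : 0 <= lam -> approx lam e `<=` approx lam e.+1.
Proof.
move=> h0; rewrite /approx /iter_root iterSr; apply: iter_rootS.
have -> : principal (f ^+ nceil (lam * (p ^ e)%:R)) =
    frobenius_root (principal (f ^+ (p * nceil (lam * (p ^ e)%:R)))).
  by rewrite mulnC exprM /principal frobenius_root_scale ?frobenius_root_setT //; exact: ideal_setT.
apply: (@iter_rootS 1); apply: principalXS.
rewrite nceil_le ?mulr_ge0 // expnS !natrM mulrCA ler_wpM2l //.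
by apply: nceil_ge; rewrite mulr_ge0.
Qed.

Local Notation tau := (test_ideal p (ideal_gen [set f])).

Lemma test_idealE lam : 0 <= lam ->
  exists e0, forall e, (e0 <= e)%N -> tau lam = approx lam e.
Proof.
move=> h0; have [e0 he0] := noeth_acc noethR (approx_ideal lam)
  (fun e => @approx_increasing lam e h0).
exists e0 => e he; apply: xget_subset1.
  by exists e0 => e' he'; rewrite test_ideal_approxE !he0.
move=> J J' [e1 h1] [e2 h2].
rewrite -(h1 (maxn e1 e2)) ?leq_maxl //; exact: h2 (leq_maxr _ _).
Qed.

Lemma test_ideal_ideal lam : 0 <= lam -> ideal (tau lam).
Proof. by move=> /test_idealE[e he]; rewrite (he e) //; exact: approx_ideal. Qed.

Lemma test_ideal_antitone lam mu : 0 <= lam -> lam <= mu -> tau mu `<=` tau lam.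
Proof.
move=> h0 h; have [e he] := test_idealE h0; have [e' he'] := test_idealE (le_trans h0 h).
rewrite (he (maxn e e')) ?leq_maxl // (he' (maxn e e')) ?leq_maxr //.
exact: approx_antitone.
Qed.

(** At a common level $e + e'$ the exponent is $r p^{e'} + \lambda p^{e'}$; its integral summand
    leaves the ceiling and comes out of the $e'$-fold root as $f^r$. *)
Lemma test_ideal_root (r e : nat) lam : 0 <= lam ->
  tau ((r%:R + lam) / (p ^ e)%:R) = iter_root e (scale (f ^+ r) (tau lam)).
Proof.
move=> h0; have p_gt0 := prime_gt0 (pcharf_prime charRp).
have q_neq0 : (p ^ e)%:R != 0 :> K by rewrite pnatr_eq0 -lt0n expn_gt0 p_gt0.
have h1 : 0 <= (r%:R + lam) / (p ^ e)%:R by rewrite divr_ge0 ?addr_ge0.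
have [e1 he1] := test_idealE h0; have [e2 he2] := test_idealE h1.
rewrite (he2 (e + maxn e1 e2)%N); last first.
  by apply: leq_trans (leq_addl _ _); exact: leq_maxr.
rewrite (he1 (maxn e1 e2)) ?leq_maxl //; set e' := maxn e1 e2.
rewrite /approx iter_rootD -iter_root_scale; last exact: principal_ideal.
congr (iter_root e (iter_root e' _)); rewrite /principal scaleA -exprM -exprD; congr (scale (f ^+ _) _).
rewrite -nceilD ?mulr_ge0 //; congr nceil.
by rewrite expnD !natrM mulrA divfK // mulrDl.
Qed.

End TestIdeal.
End FrobeniusRoots.

(** * Jumping exponents *)

Section Creeping.
Variable K : realType.
Implicit Types x y z a b : K.

(** A form of compactness of $[0,1]$: the supremum of the points reachable from 0 is itself
    reachable by the condition on the left, and equals 1 by the condition on the right. *)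
Lemma creeping (P : K -> K -> Prop) :
  (forall x y z, P x y -> P y z -> P x z) ->
  (forall x, 0 <= x -> exists2 b, x < b & forall y, x < y -> y <= b -> P x y) ->
  (forall x, 0 < x -> x <= 1 ->
     exists a, [/\ 0 <= a, a < x & forall y, a <= y -> y < x -> P y x]) ->
  P 0 1.
Proof.
move=> Ptrans Pright Pleft.
pose E : set K := [set y | [/\ 0 < y, y <= 1 & P 0 y]].
have [b0 b0_gt0 hb0] := Pright 0 (lexx _).
have E0 : E (Num.min b0 1).
  have h : 0 < Num.min b0 1 by rewrite lt_min b0_gt0 ltr01.
  by split=> //; [rewrite ge_min lexx orbT|apply: hb0 => //; rewrite ge_min lexx].
have supE : has_sup E.
  by split; [exists (Num.min b0 1)|exists 1 => y []].
pose c := sup E.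
have Ec y : E y -> y <= c by move=> hy; exact: ub_le_sup (proj2 supE) _ hy.
have c_gt0 : 0 < c by apply: lt_le_trans (Ec _ E0); case: E0.
have c_le1 : c <= 1 by apply: ge_sup; [exact: proj1 supE|move=> y []].
have P0c : P 0 c.
  have [a [a_ge0 hac ha]] := Pleft c c_gt0 c_le1.
  have [|y Ey] := @sup_adherent _ E (c - a) _ supE; first by rewrite subr_gt0.
  rewrite -/c opprB addrC subrK => hay; have [y0 y1 Py] := Ey.
  have := Ec y Ey; rewrite le_eqVlt => /orP[/eqP <- //|hyc].
  by apply: Ptrans Py _; apply: ha => //; exact: ltW.
move: c_le1; rewrite le_eqVlt => /orP[/eqP <- //|c_lt1].
have [b hcb hb] := Pright c (ltW c_gt0).
have hc : c < Num.min b 1 by rewrite lt_min hcb c_lt1.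
have : E (Num.min b 1).
  split; [exact: lt_trans c_gt0 hc|by rewrite ge_min lexx orbT|].
  by apply: Ptrans P0c _; apply: hb => //; rewrite ge_min lexx.
by move=> /Ec; rewrite leNgt hc.
Qed.

End Creeping.

(** * Jumps and left stability, globally and at a prime *)

Section Jumps.
Variables (K : realType) (R : comNzRingType) (p : nat).
Hypothesis charRp : p \in [pchar R].
Hypothesis noethR : noetherian R.
Variables (tau : K -> set R) (root : nat -> set R -> set R) (f : R).
Hypothesis root0 : forall I, root 0 I = I.
Hypothesis rootS : forall e I J, I `<=` J -> root e I `<=` root e J.
Hypothesis root_scale : forall e c I, ideal I ->
  root e (scale (c ^+ (p ^ e)) I) = scale c (root e I).
Hypothesis tau_ideal : forall lam, 0 <= lam -> ideal (tau lam).
Hypothesis tau_antitone : forall lam mu, 0 <= lam -> lam <= mu -> tau mu `<=` tau lam.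
Hypothesis tau_root : forall (r e : nat) lam, 0 <= lam ->
  tau ((r%:R + lam) / (p ^ e)%:R) = root e (scale (f ^+ r) (tau lam)).
Implicit Types (x y z lam mu nu : K) (U N : set R).

Let p_gt1 : (1 < p)%N := prime_gt1 (pcharf_prime charRp).
Let p_gt0 : (0 < p)%N := prime_gt0 (pcharf_prime charRp).

Let pX_gt0 e : 0 < (p ^ e)%:R :> K.
Proof. by rewrite ltr0n expn_gt0 p_gt0. Qed.

Lemma tauD1 lam : 0 <= lam -> tau (lam + 1) = scale f (tau lam).
Proof. by move=> h; have := @tau_root 1 0 lam h; rewrite expn0 divr1 root0 expr1 addrC. Qed.

Lemma tau_div e lam : 0 <= lam -> tau (lam / (p ^ e)%:R) = root e (tau lam).
Proof. by move=> h; have := @tau_root 0 e lam h; rewrite add0r expr0 scale1. Qed.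

(* [U] plays the role of the denominators: the complement of a prime, or [1]. *)
Definition mult_set U := U 1 /\ forall s t, U s -> U t -> U (s * t).

Definition sub_at U (I J : set R) := exists2 s, U s & forall a, I a -> J (s * a).

Definition jump U x := forall nu, 0 <= nu -> nu < x -> ~ sub_at U (tau nu) (tau x).

(** The ideal at [x] itself does not enter, so a jump can be left stable. *)
Definition left_stable U x := exists nu,
  [/\ 0 <= nu, nu < x & forall mu, nu <= mu -> mu < x -> sub_at U (tau nu) (tau mu)].

Lemma mult_set_prime N : prime_ideal N -> mult_set (~` N).
Proof. by move=> prN; split; [exact: prime1|exact: primeM]. Qed.

Lemma mult_set1 : mult_set [set 1].
Proof. by split=> // _ _ -> ->; rewrite /= mulr1. Qed.

Lemma sub_at1 (I J : set R) : sub_at [set 1] I J <-> I `<=` J.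
Proof.
split; first by move=> [_ -> h] a /h; rewrite mul1r.
by move=> h; exists 1 => // a /h; rewrite mul1r.
Qed.

(** From $sI \subseteq J$ follows $s^{p^e} I \subseteq J$, and the root takes $s^{p^e}$ back to
    $s$. *)
Lemma sub_at_root U e (I J : set R) : mult_set U -> ideal I ->
  sub_at U I J -> ideal J -> sub_at U (root e I) (root e J).
Proof.
move=> hU hI [s hs h] hJ; exists s => // a ha.
have : root e (scale (s ^+ (p ^ e)) I) (s * a) by rewrite root_scale //; exists a.
apply: rootS => _ [b hb <-].
rewrite -(prednK (_ : 0 < p ^ e)%N) ?expn_gt0 ?p_gt0 // exprSr -mulrA.
by apply: ideal_mull => //; exact: h.
Qed.

(** The ideals at $x + 1/(n+1)$ form an ascending chain. *)
Lemma right_constant x : 0 <= x ->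
  exists2 b, x < b & forall y z, x < y -> y <= z -> z <= b -> tau y = tau z.
Proof.
move=> x0; pose y n := x + n.+1%:R^-1.
have y_gt n : x < y n by rewrite ltrDl invr_gt0 ltr0n.
have y_ge0 n : 0 <= y n := le_trans x0 (ltW (y_gt n)).
have [|n hn] := noeth_acc noethR (fun n => tau_ideal (y_ge0 n)).
  move=> n; apply: tau_antitone => //.
  by rewrite lerD2l lef_pV2 ?posrE ?ltr0n // ler_nat.
exists (y n) => // u v hu huv hv.
have u0 : 0 <= u := le_trans x0 (ltW hu).
have v0 : 0 <= v := le_trans u0 huv.
apply/seteqP; split; last exact: tau_antitone.
apply: (@subset_trans _ (tau (y n))); last exact: tau_antitone.
pose k := maxn n (Num.trunc (u - x)^-1).
have hk : y k <= u.
  rewrite -lerBrDl -[leRHS]invrK lef_pV2 ?posrE ?ltr0n ?invr_gt0 ?subr_gt0 //.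
  have h : 0 <= (u - x)^-1 by rewrite invr_ge0 subr_ge0 ltW.
  have /andP[_ /ltW h2] := truncn_itv h.
  by apply: le_trans h2 _; rewrite ler_nat ltnS leq_maxr.
by rewrite -(hn k (leq_maxl _ _)); exact: tau_antitone.
Qed.

(** Taking $p$-th roots of an inclusion that refutes the jump at $px$ refutes the jump at $x$. *)
Lemma jump_mul U x : mult_set U -> 0 < x -> jump U x -> jump U (p%:R * x).
Proof.
move=> hU x0 hj nu nu0 hnu hsub.
have pK : (p ^ 1)%:R = p%:R :> K by rewrite expn1.
have pR0 : 0 < p%:R :> K by rewrite ltr0n.
apply: (hj (nu / (p ^ 1)%:R)); first by rewrite divr_ge0.
  by rewrite pK ltr_pdivrMr // mulrC.
have -> : x = p%:R * x / (p ^ 1)%:R by rewrite pK mulrC mulKf // gt_eqF.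
have px0 : 0 <= p%:R * x by rewrite mulr_ge0 // ltW.
by rewrite !tau_div //; apply: sub_at_root => //; exact: tau_ideal.
Qed.

Lemma jump_sub1 U x : 1 < x -> jump U x -> jump U (x - 1).
Proof.
move=> x1 hj nu nu0 hnu [s hs h].
apply: (hj (nu + 1)); rewrite ?addr_ge0 // -?ltrBrDr //.
have -> : x = x - 1 + 1 by rewrite subrK.
rewrite !tauD1 // ?subr_ge0 ?ltW //; exists s => // _ [a ha <-].
by exists (s * a); [exact: h|rewrite mulrCA].
Qed.

Lemma jump_subn U x n : n%:R < x -> jump U x -> jump U (x - n%:R).
Proof.
elim: n => [|n IH] hn hj; first by rewrite subr0.
have e : n.+1%:R = n%:R + 1 :> K by rewrite -addn1 natrD.
rewrite e opprD addrA; apply: jump_sub1.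
  by rewrite ltrBrDl -e.
by apply: IH => //; apply: le_lt_trans hn; rewrite ler_nat.
Qed.

Lemma unit_translate x : 0 < x -> exists n, [/\ n%:R < x & x - n%:R <= 1].
Proof.
move=> x0; have h := nceil_le _ (ltW x0).
have c0 : (0 < nceil x)%N by rewrite ltnNge h -ltNge.
(* One less than the ceiling, not the floor: the remainder has to lie in $(0,1]$. *)
exists (nceil x).-1; split.
  by rewrite ltNge -h -ltnNge prednK.
by rewrite lerBlDl natr1 prednK //; exact: nceil_ge (ltW x0).
Qed.

(** Creeping along intervals $(a,b]$: there is no jump just to the right of a point, and just to the
    left of a left stable point the only possible jump is the point itself. *)
Lemma finite_jumps U : mult_set U ->
  (forall x, 0 < x -> x <= 1 -> left_stable U x) ->
  exists s : seq K, forall x, 0 < x -> x <= 1 -> jump U x -> x \in s.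
Proof.
move=> [U1 UM] hls.
apply: (@creeping K (fun a b => exists s : seq K,
  forall x, a < x -> x <= b -> jump U x -> x \in s)).
- move=> x y z [s hs] [t ht]; exists (s ++ t) => w hxw hwz hw; rewrite mem_cat.
  have [hwy|hyw] := leP w y; first by rewrite hs.
  by rewrite orbC ht.
- move=> x x0; have [b hxb hb] := right_constant x0; exists b => // y hxy hyb.
  exists [::] => z hxz hzy hz; exfalso.
  have hm : x < (x + z) / 2 by rewrite midf_lt.
  apply: (hz ((x + z) / 2)); [by rewrite (le_trans x0) ?ltW|by rewrite midf_lt|].
  exists 1 => // a; rewrite mul1r (hb _ z) //; first by rewrite ltW ?midf_lt.
  exact: le_trans hyb.
- move=> x x0 x1; have [nu [nu0 hnu hnux]] := hls x x0 x1.
  exists nu; split=> // y hy hyx; exists [:: x] => z hyz hzx hz.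
  rewrite mem_seq1; move: hzx; rewrite le_eqVlt => /orP[//|hzx]; exfalso.
  apply: (hz nu) => //; first exact: le_lt_trans hyz.
  by apply: hnux => //; apply: ltW; exact: le_lt_trans hyz.
Qed.

(** The shape that an eventually periodic orbit of $x \mapsto px$ modulo 1 imposes on its starting
    point, and the one that [pole_left_stable] can treat. *)
Definition p_rational x := exists (i e r : nat),
  [/\ (0 < e)%N, (0 < r)%N & x = r%:R / ((p ^ e)%:R - 1) / (p ^ i)%:R].

(** Multiplying by [p] and translating back into $(0,1]$ preserves jumps, of which there are
    finitely many. By the pigeonhole principle two terms of the orbit agree, and $(p^j - p^i)x$ is
    an integer. *)
Lemma jump_p_rational U x : mult_set U ->
  (forall x, 0 < x -> x <= 1 -> left_stable U x) ->
  0 < x -> x <= 1 -> jump U x -> p_rational x.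
Proof.
move=> hU hls x0 x1 hj; have [s hs] := finite_jumps hU hls.
pose good y := [/\ 0 < y, y <= 1 & jump U y].
have /choice[nx hnx] y : exists z, good y -> good z /\ exists k : nat, z = p%:R * y - k%:R.
  have [[y0 y1 hy]|h] := pselect (good y); last by exists 0.
  have py0 : 0 < p%:R * y by rewrite mulr_gt0 // ltr0n.
  have [n [hn1 hn2]] := unit_translate py0.
  exists (p%:R * y - n%:R) => _; split; last by exists n.
  split=> //; first by rewrite subr_gt0.
  by apply: jump_subn => //; exact: jump_mul.
pose it n := iter n nx x.
have git n : good (it n) by elim: n => [//|n IH]; exact: (proj1 (hnx _ IH)).
have eit n : exists k : nat, it n = (p ^ n)%:R * x - k%:R.
  elim: n => [|n [k hk]]; first by exists 0%N; rewrite expn0 mul1r subr0.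
  have [_ [l hl]] := hnx _ (git n).
  exists (p * k + l)%N; rewrite /it iterS -/(it n) hl hk expnS natrD !natrM.
  by rewrite mulrBr mulrA opprD addrA.
have [i [j [hij e]]] : exists i j, (i < j)%N /\ it i = it j.
  apply: contrapT => hno.
  have uniq_t : uniq [seq it k | k <- iota 0 (size s).+1].
    apply: contraT => /(uniqPn 0)[i [j [hij]]]; rewrite size_map size_iota => hj' e.
    exfalso; apply: hno; exists i, j; split=> //.
    by move: e; rewrite !(nth_map 0%N) ?size_iota ?(ltn_trans hij) // !nth_iota ?(ltn_trans hij).
  have sub_t : {subset [seq it k | k <- iota 0 (size s).+1] <= s}.
    by move=> _ /mapP[k _ ->]; have [] := git k; exact: hs.
  by have := uniq_leq_size uniq_t sub_t; rewrite size_map size_iota ltnn.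
have [k hk] := eit i; have [l hl] := eit j.
have e1 : (1 < p ^ (j - i))%N by rewrite -{1}(expn0 p) ltn_exp2l // subn_gt0.
have hpj : (p ^ j)%:R = (p ^ i)%:R * (p ^ (j - i))%:R :> K.
  by rewrite -natrM -expnD subnKC // ltnW.
have q_gt0 : 0 < (p ^ (j - i))%:R - 1 :> K by rewrite subr_gt0 ltr1n.
have eq : (p ^ i)%:R * ((p ^ (j - i))%:R - 1) * x = l%:R - k%:R.
  by move: e; rewrite hk hl hpj => e; lra.
have hkl : (k < l)%N.
  by rewrite -(ltr_nat K) -subr_gt0 -eq !mulr_gt0.
exists i, (j - i)%N, (l - k)%N; split; rewrite ?subn_gt0 //.
rewrite natrB ?(ltnW hkl) // -eq.
by field; rewrite ?gt_eqF //= ; apply/andP; split; rewrite gt_eqF.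
Qed.

(* The Hartshorne-Speiser-Lyubeznik-Gabber argument: [J n] is the chain of images of the [p^-e]-linear
   operator [phi], and [c J n <= J n.+1] forces [c ^+ 2 J n <= phi (c ^+ 2 J n)], hence [c ^+ 2 J n <= J m]
   for all [m]. *)
Lemma pole_left_stable (r e : nat) : (0 < e)%N -> (0 < r)%N ->
  left_stable [set 1] (r%:R / ((p ^ e)%:R - 1)).
Proof.
move=> e0 r0; set x := _ / _; set q : K := (p ^ e)%:R in x *.
have q1 : (1 < p ^ e)%N by rewrite -{1}(expn0 p) ltn_exp2l.
have q_gt1 : 1 < q by rewrite /q ltr1n.
have hq1 : 0 < q - 1 by rewrite subr_gt0.
have x0 : 0 < x by rewrite divr_gt0 ?ltr0n.
(* This sequence starts at 0, increases to [x] and satisfies $u_{n+1} = (r + u_n)/q$, so each of its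
   test ideals is the image of the previous one under [phi]. *)
pose u n := x - x * q^-1 ^+ n.
have qi : 0 < q^-1 < 1 by rewrite invr_gt0 invf_lt1 ?q_gt1 ?(lt_trans ltr01) //.
have qn n : 0 < q^-1 ^+ n <= 1.
  case/andP: qi => h1 h2; rewrite exprn_gt0 //= exprn_ile1 //; exact: ltW.
have u_ge0 n : 0 <= u n.
  by rewrite subr_ge0 ler_piMr ?(ltW x0) //; case/andP: (qn n).
have u_lt n : u n < x by rewrite ltrBlDr ltrDl mulr_gt0 //; case/andP: (qn n).
pose phi I := root e (scale (f ^+ r) I).
have uS n : u n.+1 = (r%:R + u n) / q.
  have -> : r%:R = x * (q - 1) by rewrite divfK // gt_eqF.
  rewrite /u exprS; have := gt_eqF (lt_trans ltr01 q_gt1) => hq.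
  by field; rewrite hq.
pose J n := tau (u n).
have JS n : J n.+1 = phi (J n) by rewrite /J uS tau_root.
have hJ n : ideal (J n) := tau_ideal (u_ge0 n).
have u_mono m n : (m <= n)%N -> u m <= u n.
  move=> h; rewrite lerD2l lerN2 ler_pM2l //.
  by case/andP: qi => h1 h2; rewrite ler_wiXn2l // ltW.
have decJ m n : (m <= n)%N -> J n `<=` J m by move=> h; apply: tau_antitone => //; exact: u_mono.
have key c n : (forall a, J n a -> J n.+1 (c * a)) -> eventual_conductor J (c ^+ 2).
  move=> hc; exists n => m hm a ha; move: hm => /subnK <-.
  have hI : ideal (scale (c ^+ 2) (J n)) := scale_ideal _ (hJ n).
  suff : forall k, scale (c ^+ 2) (J n) `<=` J (k + n)%N by apply; exists a.
  elim=> [|k IHk]; first exact: scale_sub.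
  rewrite addSn JS => _ [b hb <-].
  have : scale c (phi (J n)) (c ^+ 2 * b).
    by exists (c * b); [rewrite -JS; exact: hc|rewrite mulrA].
  rewrite /phi -root_scale; last exact: scale_ideal.
  apply: rootS; rewrite scaleA mulrC -scaleA; apply: scaleS.
  (* As $p^e \ge 2$, the factor $c^{p^e}$ contains the square that the induction hypothesis asks
     for. *)
  apply: subset_trans IHk => _ [d hd <-].
  exists (c ^+ (p ^ e - 2) * d); first exact: ideal_mull.
  by rewrite mulrA -exprD subnKC.
(* At a minimal prime [N] of a proper conductor the chain is stable, so some [s] outside [N] carries
   [J n] into [J n.+1]; then [key] puts [s ^+ 2] in [N]. *)
have h1 : eventual_conductor J 1.
  apply: contrapT => h1.
  have [N [minN prN hDN]] := exists_minimal_over noethR (eventual_conductor_ideal hJ decJ) h1.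
  have [n hn] := chain_stable_at noethR hJ decJ minN.
  have [s hs hsn] := hn n.+1 (leqnSn n).
  by apply: (primeX prN hs) (hDN _ (key s n hsn)).
have [n hn] := h1; exists (u n); split=> // mu hmu1 hmu2.
apply/sub_at1.
have [k hk] : exists k, mu <= u k.
  have hd : 0 < (x - mu) / x by rewrite divr_gt0 // subr_gt0.
  case/andP: qi => h0 hlt.
  have : (fun n => q^-1 ^+ n) @ \oo --> 0 by apply: cvg_expr; rewrite gtr0_norm.
  move=> /cvgrPdist_le /(_ _ hd) [k _ hk]; exists k.
  have := hk k (leqnn k); rewrite sub0r normrN gtr0_norm; last by case/andP: (qn k).
  by rewrite ler_pdivlMr // /u => h; lra.
have hm : mu <= u (maxn n k) by apply: le_trans hk _; apply: u_mono; exact: leq_maxr.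
have mu0 : 0 <= mu := le_trans (u_ge0 n) hmu1.
apply: (@subset_trans _ (J (maxn n k))); last exact: tau_antitone.
by move=> a ha; rewrite -[a]mul1r; apply: hn => //; exact: leq_maxl.
Qed.

Lemma left_stable_div x i : left_stable [set 1] x -> left_stable [set 1] (x / (p ^ i)%:R).
Proof.
move=> [nu [nu0 hnu h]]; have pi0 := pX_gt0 i.
exists (nu / (p ^ i)%:R); split; first by rewrite divr_ge0 // ltW.
  by rewrite ltr_pM2r // invr_gt0.
move=> mu; rewrite ler_pdivrMr // ltr_pdivlMr // => h1 h2.
have /sub_at1 h3 := h _ h1 h2; apply/sub_at1.
have -> : mu = mu * (p ^ i)%:R / (p ^ i)%:R by rewrite mulfK // gt_eqF.
have h4 : 0 <= mu * (p ^ i)%:R := le_trans nu0 h1.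
by rewrite !tau_div //; exact: rootS.
Qed.

Lemma p_rational_left_stable x : p_rational x -> left_stable [set 1] x.
Proof.
by move=> [i [e [r [e0 r0 ->]]]]; apply: left_stable_div; exact: pole_left_stable.
Qed.

(** The exponents start at 0 and increase to [x], so the behaviour to the left of [x] is that of one
    descending chain. *)
Definition left_chain x n := tau (x - x / n.+1%:R).

Section LeftChain.
Variable x : K.
Hypothesis x_gt0 : 0 < x.

Let arg_ge0 n : 0 <= x - x / n.+1%:R.
Proof. by rewrite subr_ge0 ler_pdivrMr ?ltr0n // ler_peMr ?ler1n // ltW. Qed.
Let arg_lt n : x - x / n.+1%:R < x.
Proof. by rewrite ltrBlDr ltrDl divr_gt0 ?ltr0n. Qed.
Let arg_mono m n : (m <= n)%N -> x - x / m.+1%:R <= x - x / n.+1%:R.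
Proof.
move=> h; rewrite lerD2l lerN2 ler_pM2l // lef_pV2 ?posrE ?ltr0n //.
by rewrite ler_nat ltnS.
Qed.
Let arg_cofinal mu : mu < x -> exists n, mu <= x - x / n.+1%:R.
Proof.
move=> h; pose k := Num.trunc (x / (x - mu)); exists k.
have hd : 0 < x - mu by rewrite subr_gt0.
have h0 : 0 <= x / (x - mu) by rewrite divr_ge0 ?ltW.
have /andP[_] := truncn_itv h0; rewrite -/k => h2.
rewrite lerBrDl -lerBrDr ler_pdivrMr ?ltr0n //.
by move: h2; rewrite ltr_pdivrMr // mulrC => /ltW.
Qed.

Lemma left_chain_ideal n : ideal (left_chain x n).
Proof. exact: tau_ideal (arg_ge0 n). Qed.

Lemma left_chain_dec m n : (m <= n)%N -> left_chain x n `<=` left_chain x m.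
Proof. by move=> h; apply: tau_antitone => //; exact: arg_mono. Qed.

Lemma left_stable_of_chain U n :
  (forall m, (n <= m)%N -> sub_at U (left_chain x n) (left_chain x m)) -> left_stable U x.
Proof.
move=> h; exists (x - x / n.+1%:R); split=> // mu h1 h2.
have [k hk] := arg_cofinal h2.
have [s hs hn] := h (maxn n k) (leq_maxl _ _); exists s => // a /hn.
apply: tau_antitone; first exact: le_trans (arg_ge0 n) h1.
by apply: le_trans hk _; apply: arg_mono; exact: leq_maxr.
Qed.

Lemma left_conductor s nu : 0 <= nu -> nu < x ->
  (forall mu, nu <= mu -> mu < x -> forall a, tau nu a -> tau mu (s * a)) ->
  eventual_conductor (left_chain x) s.
Proof.
move=> nu0 hnu h; have [n hn] := arg_cofinal hnu; exists n => m hm a ha.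
apply: h => //; first by apply: le_trans hn _; exact: arg_mono.
by apply: tau_antitone ha.
Qed.

End LeftChain.

Lemma frobXD (a b : R) e : (a + b) ^+ (p ^ e) = a ^+ (p ^ e) + b ^+ (p ^ e).
Proof.
elim: e => [|e IH]; first by rewrite expn0 !expr1.
by rewrite expnSr !exprM IH frobD.
Qed.

(* The elements [c] such that every point of (0, 1] is left stable after inverting [c]. If they generated
   a proper ideal, localise at a minimal prime [N] of it: there the test ideals have finite colength along
   each left chain, so jumps are finitely many, hence rational, hence globally left stable, and a single
   denominator outside [N] works everywhere. *)
Lemma all_left_stable x : 0 < x -> x <= 1 -> left_stable [set 1] x.
Proof.
pose D x := eventual_conductor (left_chain x).
have hD y : 0 < y -> ideal (D y).
  move=> y0; apply: eventual_conductor_ideal; first exact: left_chain_ideal.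
  exact: left_chain_dec.
(* [A] is the intersection of the radicals of the conductors [D y]; exponents that are powers of [p]
   make its additivity immediate. *)
pose A : set R := [set c | forall y, 0 < y -> y <= 1 -> exists e, D y (c ^+ (p ^ e))].
have hA : ideal A.
  split.
  - move=> y y0 y1; exists 0%N; rewrite expn0 expr1; exact: ideal0 (hD y y0).
  - move=> a b ha hb y y0 y1; have [e he] := ha y y0 y1; have [e' he'] := hb y y0 y1.
    have up c i j : D y (c ^+ (p ^ i)) -> D y (c ^+ (p ^ (i + j))).
      move=> h; rewrite expnD exprM -(prednK (_ : 0 < p ^ j)%N) ?expn_gt0 ?p_gt0 //.
      by rewrite exprS; apply: ideal_mulr h; exact: hD.
    exists (e + e')%N; rewrite frobXD; apply: idealD; first exact: hD.
      exact: up.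
    by rewrite addnC; exact: up.
  - move=> a c hc y y0 y1; have [e he] := hc y y0 y1; exists e.
    by rewrite exprMn; apply: ideal_mull he; exact: hD.
suff hA1 : A 1.
  move=> x0 x1; have [e] := hA1 x x0 x1; rewrite expr1n => -[n hn].
  apply: (left_stable_of_chain x0 (n := n)) => m hm; apply/sub_at1 => a ha.
  by rewrite -[a]mul1r; exact: hn.
apply: contrapT => hA1.
have [N [[_ minN] prN hAN]] := exists_minimal_over noethR hA hA1.
have hU := mult_set_prime prN.
have lsN y : 0 < y -> y <= 1 -> left_stable (~` N) y.
  move=> y0 y1.
  have minD : minimal_over (D y) N.
    split=> // P prP hDP hPN; apply: minN => // c hc; have [e he] := hc y y0 y1.
    by apply: contrapT => hcP; apply: (primeX prP hcP) (hDP _ he).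
  have [n hn] := chain_stable_at noethR (left_chain_ideal y0) (left_chain_dec y0) minD.
  exact: (left_stable_of_chain y0 hn).
(* A jump at [N] is [p_rational], hence globally left stable, and 1 is a denominator. At any other
   point, the denominator comparing [tau nu] with [tau y] serves every [mu] in between. *)
have loc y : 0 < y -> y <= 1 -> exists s nu, [/\ ~ N s, 0 <= nu, nu < y &
    forall mu, nu <= mu -> mu < y -> forall a, tau nu a -> tau mu (s * a)].
  move=> y0 y1; have [hj|/existsNP[nu]] := pselect (jump (~` N) y).
    have [nu [nu0 hnu h]] := p_rational_left_stable (jump_p_rational hU lsN y0 y1 hj).
    exists 1, nu; split=> //; first exact: prime1.
    by move=> mu h1 h2 a; rewrite mul1r; move: a; exact/sub_at1/h.
  move=> /not_implyP[nu0 /not_implyP[hnu /contrapT[s hs h]]].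
  exists s, nu; split=> // mu h1 h2 a /h; apply: tau_antitone; last exact: ltW.
  exact: le_trans nu0 h1.
(* One denominator for all points of $(a,b]$; those of adjacent intervals are multiplied. *)
pose P a b := exists2 s, ~ N s & forall y, a < y -> y <= b -> exists nu, [/\ 0 <= nu, nu < y &
    forall mu, nu <= mu -> mu < y -> forall a, tau nu a -> tau mu (s * a)].
have [s hs h] : P 0 1.
  apply: creeping.
  - move=> a b c [s hs hab] [t ht hbc]; exists (s * t); first exact: primeM.
    move=> y hay hyc; have [hyb|hby] := leP y b.
      have [nu [nu0 hnu h]] := hab y hay hyb; exists nu; split=> // mu h1 h2 d hd.
      rewrite mulrAC mulrC; apply: ideal_mull; last exact: h.
      exact: tau_ideal (le_trans nu0 h1).
    have [nu [nu0 hnu h]] := hbc y hby hyc; exists nu; split=> // mu h1 h2 d hd.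
    rewrite -mulrA; apply: ideal_mull; last exact: h.
    exact: tau_ideal (le_trans nu0 h1).
  - move=> y y0; have [b hyb hb] := right_constant y0; exists b => // z hyz hzb.
    exists 1; first exact: prime1.
    move=> w hyw hwz; have hm : y < (y + w) / 2 by rewrite midf_lt.
    exists ((y + w) / 2); split; [by rewrite (le_trans y0) ?ltW|by rewrite midf_lt|].
    move=> mu h1 h2 a; rewrite mul1r (hb _ mu) //.
    exact: le_trans (ltW h2) (le_trans hwz hzb).
  - move=> y y0 y1; have [s [nu [hs nu0 hnu h]]] := loc y y0 y1.
    exists nu; split=> // z hz hzy; exists s => // w hzw hwy; exists nu; split=> //.
      exact: le_lt_trans hzw.
    by move=> mu h1 h2; apply: h => //; exact: lt_le_trans hwy.
apply: hs; apply: hAN => y y0 y1; exists 0%N; rewrite expn0 expr1.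
by have [nu [nu0 hnu h']] := h y y0 y1; exact: (left_conductor y0 nu0 hnu).
Qed.

Lemma left_stable_add n x : 0 < x -> left_stable [set 1] x -> left_stable [set 1] (x + n%:R).
Proof.
move=> x0 hx; elim: n => [|n [nu [nu0 hnu h]]]; first by rewrite addr0.
rewrite -natr1 addrA; exists (nu + 1); split; [exact: addr_ge0|by rewrite ltrD2r|].
move=> mu; rewrite -lerBrDr -ltrBlDr => h1 h2; apply/sub_at1.
have /sub_at1 h3 := h _ h1 h2.
have -> : mu = mu - 1 + 1 by rewrite subrK.
by rewrite !tauD1 ?(le_trans nu0) //; exact: scaleS.
Qed.

Lemma left_stable_pos x : 0 < x -> left_stable [set 1] x.
Proof.
move=> x0; have [n [h1 h2]] := unit_translate x0.
rewrite -(subrK n%:R x); have h : 0 < x - n%:R by rewrite subr_gt0.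
by apply: left_stable_add => //; exact: all_left_stable.
Qed.

Lemma jump_rational x : 0 < x -> jump [set 1] x -> exists q : rat, x = ratr q.
Proof.
move=> x0 hj; have [n [h1 h2]] := unit_translate x0.
have h : 0 < x - n%:R by rewrite subr_gt0.
have [i [e [r [_ _ e']]]] :=
  jump_p_rational mult_set1 all_left_stable h h2 (jump_subn h1 hj).
exists (r%:R / ((p ^ e)%:R - 1) / (p ^ i)%:R + n%:R).
rewrite rmorphD !fmorph_div rmorphB /= rmorph1 !ratr_nat -e'; by rewrite subrK.
Qed.

Lemma jump_isolated x : 0 <= x -> exists2 b, x < b &
  forall y, x < y -> y <= b -> ~ jump [set 1] y.
Proof.
move=> x0; have [b hxb hb] := right_constant x0; exists b => // y hxy hyb hj.
have hm : x < (x + y) / 2 by rewrite midf_lt.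
apply: (hj ((x + y) / 2)); [by rewrite (le_trans x0) ?ltW|by rewrite midf_lt|].
by apply/sub_at1; rewrite (hb _ y) // ltW ?midf_lt.
Qed.

(** Constancy to the right and left stability isolate a positive [x]; the bound $\nu \ge 0$ also
    keeps the conventional exponent 0 out of the interval. *)
Lemma jump_discrete x : exists a b, [/\ a < x, x < b &
  forall y, a < y -> y < b -> y = 0 \/ 0 < y /\ jump [set 1] y -> y = x].
Proof.
have [x_lt0|x_gt0|->] := ltgtP x 0.
- exists (x - 1), 0; split=> //; first by rewrite ltrBlDr ltrDl.
  move=> y _ y1 [e|[y2 _]]; first by rewrite e ltxx in y1.
  by have := lt_trans y1 y2; rewrite ltxx.
- have [b hxb hb] := jump_isolated (ltW x_gt0).
  have [nu [nu0 hnu h]] := left_stable_pos x_gt0.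
  exists nu, b; split=> // y hy1 hy2 [e|[y0 hj]]; first by rewrite e ltNge nu0 in hy1.
  have [hlt|hlt|//] := ltgtP y x; exfalso; last exact: (hb y hlt (ltW hy2) hj).
  by apply: (hj nu) => //; apply: h => //; exact: ltW.
- have [b hxb hb] := jump_isolated (lexx 0); exists (- 1), b; split=> //.
  by move=> y _ hyb [//|[y0 hj]]; exfalso; exact: (hb y y0 (ltW hyb) hj).
Qed.

End Jumps.

Theorem theorem1p1 (K : realType) (p : nat) (R : comNzRingType)
    (charRp : p \in [pchar R]) (regR : regular_ring R)
    (FfinR : F_finite charRp) (f : R) :
  (forall lam : K, F_jumping_exponent p (ideal_gen [set f]) lam ->
     exists q : rat, lam = ratr q) /\
  (forall x : K,
     ~ limit_point (F_jumping_exponent p (ideal_gen [set f]) : set K) x).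
Proof.
have noethR : noetherian R := proj1 regR.
have [T [g [u [lin_g dual1]]]] := regular_frob_split regR FfinR.
have dual b : b = \sum_j g j b ^+ p * u j by rewrite -dual1 expr1n mul1r.
pose tau : K -> set R := test_ideal p (ideal_gen [set f]).
have tau_ideal : forall lam, 0 <= lam -> ideal (tau lam).
  by move=> *; apply: (test_ideal_ideal charRp lin_g dual).
have tau_anti : forall lam mu, 0 <= lam -> lam <= mu -> tau mu `<=` tau lam.
  by move=> *; apply: (test_ideal_antitone charRp lin_g dual).
have tau_root : forall (r e : nat) lam, 0 <= lam ->
    tau ((r%:R + lam) / (p ^ e)%:R) = iter_root g e (scale (f ^+ r) (tau lam)).
  by move=> *; apply: (test_ideal_root charRp lin_g dual).
have r_S := @iter_rootS R T g.
have r_scale   := iter_root_scale lin_g.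
have r_0 I : iter_root g 0 I = I by [].
(* Since [tau] is antitone, inequality of two test ideals amounts to the failure of one
   inclusion. *)
have jumpP (lam : K) : F_jumping_exponent p (ideal_gen [set f]) lam ->
    lam = 0 \/ 0 < lam /\ jump tau [set 1] lam.
  move=> [->|[l0 h]]; [by left|right; split=> // nu nu0 hnu /sub_at1 hsub].
  by apply: (h nu nu0 hnu); apply/seteqP; split=> //; apply: tau_anti => //; exact: ltW.
split=> [lam /jumpP[->|[l0 hj]]|x hx]; first by exists 0; rewrite rmorph0.
  exact: (jump_rational charRp noethR r_0 r_S r_scale tau_ideal tau_anti tau_root l0 hj).
have [a [b [hax hxb h]]] :=
  jump_discrete charRp noethR r_0 r_S r_scale tau_ideal tau_anti tau_root x.
have [|y [yx hy]] := hx [set` `]a, b[]; first by apply: near_in_itvoo; rewrite in_itv /= hax hxb.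
rewrite /= in_itv /= => /andP[hay hyb].
by move: yx => /eqP; apply; apply: h => //; exact: jumpP.
Qed.
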